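(* Let $n\ge 2$ and let $f:\mathbb T^{n+1}\to\mathbb T^{n+1}$ be a partially hyperbolic diffeomorphism with splitting $T\mathbb T^{n+1}=E^s\oplus E^c\oplus E^u$ such that $\dim E^s=\dim E^c=1$. Suppose that $f$ is leaf conjugate to its linear part with respect to a center foliation $\mathcal W^c$, and suppose that there is a compact incompressible $cu$-submanifold $T$ of $f$. Then for every $x\in T$, the leaf $\mathcal W^c(x)$ of $\mathcal W^c$ through $x$ is not contained in $T$.
   Context: A diffeomorphism $f:M\to M$ of a closed connected Riemannian manifold is partially hyperbolic if $TM$ has a non-trivial $df$-invariant splitting $TM=E^s\oplus E^c\oplus E^u$ such that, for some Riemannian metric, $\|df|_{E^s}\|<1$, $\|df^{-1}|_{E^u}\|<1$, and for every $p\in M$ and unit vectors $v^\sigma\in E^\sigma_p$ ($\sigma=s,c,u$) one has $\|df_pv^s\|<\|df_pv^c\|<\|df_pv^u\|$. Write $E^{cu}=E^c\oplus E^u$. A $cu$-submanifold is an (injectively) immersed submanifold tangent to $E^{cu}$. An immersed submanifold $S\subset M$ is incompressible if the homomorphism $i_*:\pi_1(S)\to\pi_1(M)$ induced by the inclusion is injective. The linear part of $f$ is the toral automorphism $N$ induced by $f_*:\pi_1(\mathbb T^{n+1})\to\pi_1(\mathbb T^{n+1})$. A center foliation $\mathcal W^c$ is an $f$-invariant foliation tangent to $E^c$. One says that $f$ is leaf conjugate to its linear part with respect to $\mathcal W^c$ if $N$ is partially hyperbolic (with one-dimensional stable and center bundles), and there is a homeomorphism $\psi:\mathbb T^{n+1}\to\mathbb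 T^{n+1}$ mapping leaves of $\mathcal W^c$ onto leaves of the linear center foliation of $N$ such that $\psi(f(\mathcal L))=N(\psi(\mathcal L))$ for every leaf $\mathcal L$ of $\mathcal W^c$. *)

(* Defs.v *)
From HB Require Import structures.
From mathcomp Require Import all_boot all_order all_algebra.
From mathcomp Require Import generic_quotient.
From mathcomp Require Import all_classical all_reals all_analysis.

Set Implicit Arguments.
Unset Strict Implicit.
Unset Printing Implicit Defensive.

Import Order.TTheory GRing.Theory Num.Theory.
Import numFieldNormedType.Exports.

Local Open Scope classical_set_scope.
Local Open Scope quotient_scope.
Local Open Scope ring_scope.

Section Torus.
Variables (R : realType) (m : nat).

Definition lattice_equiv (x y : 'rV[R]_m) : bool :=
  [forall i, x ord0 i - y ord0 i \is a Num.int].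

Lemma lattice_equiv_is_equiv : equiv_class_of lattice_equiv.
Proof.
split=> [x|x y|y x z].
- by apply/forallP => i; rewrite subrr rpred0.
- by apply/forallP/forallP => h i; rewrite -opprB rpredN.
- move=> /forallP xy /forallP yz; apply/forallP => i.
  by rewrite -(subrKA (y ord0 i)) rpredD.
Qed.

Canonical lattice_equiv_rel := EquivRelPack lattice_equiv_is_equiv.

(* R^m / Z^m with the quotient topology. *)
Definition torus := quotient_topology {eq_quot lattice_equiv}.
HB.instance Definition _ := Topological.on torus.
HB.instance Definition _ := Quotient.on torus.

Definition tproj (x : 'rV[R]_m) : torus := \pi_torus x.

End Torus.

Section Smoothness.
Variable R : realType.

Fixpoint Ck (m k : nat) (a : 'rV[R]_m -> R) : Prop :=
  if k is k'.+1 then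
    (forall x, differentiable a x) /\
    (forall j : 'I_m, Ck k' (fun x => derive a x (delta_mx ord0 j)))
  else continuous a.

Definition C1_on (d m : nat) (V : set 'rV[R]_d) (phi : 'rV[R]_d -> 'rV[R]_m) :=
  forall v, V v -> differentiable phi v /\ {for v, continuous (jacobian phi)}.

(* The tangent space of R^m / Z^m at every point is identified with 'rV[R]_m
   by translation; A is the matrix of df_p, acting on row vectors on the right.
   F is a local lift of f, so that this is differentiability in the charts
   given by local inverses of tproj. *)
Definition is_tangent_map (m : nat) (f : torus R m -> torus R m)
    (p : torus R m) (A : 'M[R]_m) :=
  exists (x : 'rV[R]_m) (F : 'rV[R]_m -> 'rV[R]_m),
    [/\ tproj x = p,
        (\forall y \near x, tproj (F y) = f (tproj y)),
        differentiable F x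
      & 'J F x = A].

(* f is a C^1 diffeomorphism with inverse g, and Df, Dg are the tangent maps. *)
Definition C1_diffeomorphism (m : nat) (f g : torus R m -> torus R m)
    (Df Dg : torus R m -> 'M[R]_m) :=
  [/\ cancel f g, cancel g f,
      continuous Df /\ (forall p, is_tangent_map f p (Df p))
    & continuous Dg /\ (forall p, is_tangent_map g p (Dg p))].

(* G p is the Gram matrix of the inner product at p. *)
Definition riemannian_metric (m : nat) (G : torus R m -> 'M[R]_m) :=
  [/\ (forall (k : nat) (i j : 'I_m), Ck k (fun x => G (tproj x) i j)),
      (forall p, (G p)^T = G p)
    & (forall p (v : 'rV[R]_m), v != 0 -> 0 < (v *m G p *m v^T) ord0 ord0)].

Definition rnorm (m : nat) (G : torus R m -> 'M[R]_m) (p : torus R m)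
    (v : 'rV[R]_m) : R :=
  Num.sqrt ((v *m G p *m v^T) ord0 ord0).

End Smoothness.

Section PartiallyHyperbolic.
Variables (R : realType) (m : nat).
Local Notation T := (torus R m).
Local Notation E := 'rV[R]_m.

(* Continuous subbundles of the tangent bundle, by local continuous frames. *)
Definition subbundle (B : T -> {vspace E}) :=
  forall p, exists X : 'I_(\dim (B p)) -> T -> E,
    \forall q \near p,
      [/\ \dim (B q) = \dim (B p),
          (forall i, {for q, continuous (X i)})
        & B q = (\sum_i <[X i q]>)%VS].

Definition invariant_subbundle (f : T -> T) (Df : T -> 'M[R]_m)
    (B : T -> {vspace E}) :=
  subbundle B /\ forall p, (linfun (mulmxr (Df p)) @: B p)%VS = B (f p).

Definition partially_hyperbolic (f : T -> T) (Es Ec Eu : T -> {vspace E}) :=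
  exists (g : T -> T) (Df Dg : T -> 'M[R]_m),
    [/\ C1_diffeomorphism f g Df Dg,
        [/\ invariant_subbundle f Df Es, invariant_subbundle f Df Ec
          & invariant_subbundle f Df Eu],
        (forall p, [/\ Es p != 0%VS, Ec p != 0%VS & Eu p != 0%VS]),
        (forall p, (Es p + Ec p + Eu p)%VS = fullv /\
                   directv (Es p + Ec p + Eu p))
      & exists2 G : T -> 'M[R]_m, riemannian_metric G &
        [/\ (exists2 lam : R, lam < 1 & forall p v, v \in Es p ->
               rnorm G (f p) (v *m Df p) <= lam * rnorm G p v),
            (exists2 lam : R, lam < 1 & forall p v, v \in Eu p ->
               rnorm G (g p) (v *m Dg p) <= lam * rnorm G p v)
          & (forall p vs vc vu,
               vs \in Es p -> vc \in Ec p -> vu \in Eu p ->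
               rnorm G p vs = 1 -> rnorm G p vc = 1 -> rnorm G p vu = 1 ->
               rnorm G (f p) (vs *m Df p) < rnorm G (f p) (vc *m Df p) /\
               rnorm G (f p) (vc *m Df p) < rnorm G (f p) (vu *m Df p))]].

End PartiallyHyperbolic.

Section Submanifolds.
Variables (R : realType) (m : nat).
Local Notation T := (torus R m).

(* h : V -> S is a homeomorphism from an open subset of R^d onto an open subset
   of S, in which iota is given by phi followed by the projection to the torus,
   where phi is a C^1 immersion. *)
Definition immersed_chart (d : nat) (S : topologicalType) (iota : S -> T)
    (V : set 'rV[R]_d) (h : 'rV[R]_d -> S) (phi : 'rV[R]_d -> 'rV[R]_m) :=
  [/\ open V /\ (forall v, V v -> {for v, continuous h}),
      {in V &, injective h},
      (forall O, open O -> O `<=` V -> open (h @` O)),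
      (forall v, V v -> tproj (phi v) = iota (h v))
    & C1_on V phi /\ (forall v, V v -> \rank ('J phi v) = d)].

(* Injectively immersed C^1 submanifolds without boundary. The topology of S
   may be finer than the one induced by iota. The immersed charts determine the
   differentiable structure of S: their transition maps are C^1. *)
Definition immersed_submanifold (d : nat) (S : topologicalType)
    (iota : S -> T) :=
  [/\ injective iota, @second_countable S
    & forall s, exists (V : set 'rV[R]_d) h phi,
        immersed_chart iota V h phi /\ (h @` V) s].

(* The tangent space of S at h v is the row space of the Jacobian of phi. *)
Definition tangent_to (d : nat) (S : topologicalType) (iota : S -> T)
    (B : T -> {vspace 'rV[R]_m}) :=
  forall (V : set 'rV[R]_d) h phi, immersed_chart iota V h phi ->
  forall v, V v -> limg (linfun (mulmxr ('J phi v))) = B (iota (h v)).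

End Submanifolds.

Section FundamentalGroup.
Variable R : realType.

Definition is_loop (X : topologicalType) (x0 : X) (c : R -> X) :=
  [/\ {within `[0, 1], continuous c}, c 0 = x0 & c 1 = x0].

Definition loop_homotopic (X : topologicalType) (x0 : X) (c0 c1 : R -> X) :=
  exists H : R * R -> X,
    [/\ {within `[0, 1] `*` `[0, 1], continuous H},
        (forall t, `[0, 1]%classic t -> H (t, 0) = c0 t /\ H (t, 1) = c1 t)
      & (forall s, `[0, 1]%classic s -> H (0, s) = x0 /\ H (1, s) = x0)].

(* pi_1(S, s0) -> pi_1(M, iota s0) is injective for every base point s0. *)
Definition incompressible (S M : topologicalType) (iota : S -> M) :=
  forall (s0 : S) (c0 c1 : R -> S), is_loop s0 c0 -> is_loop s0 c1 ->
    loop_homotopic (iota s0) (iota \o c0) (iota \o c1) ->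
    loop_homotopic s0 c0 c1.

(* The loop c represents the element k of pi_1(R^m / Z^m) = Z^m. *)
Definition loop_class (m : nat) (c : R -> torus R m) (k : 'rV[int]_m) :=
  exists l : R -> 'rV[R]_m,
    [/\ {within `[0, 1], continuous l},
        (forall t, `[0, 1]%classic t -> tproj (l t) = c t)
      & l 1 - l 0 = map_mx intr k].

(* A is the matrix of f_* on pi_1(R^m / Z^m) = Z^m. *)
Definition linear_part (m : nat) (f : torus R m -> torus R m)
    (A : 'M[int]_m) :=
  forall c k, loop_class c k -> loop_class (f \o c) (k *m A).

Definition toral_map (m : nat) (A : 'M[int]_m) (p : torus R m) : torus R m :=
  tproj (repr p *m map_mx intr A).

End FundamentalGroup.

Section Foliations.
Variables (R : realType) (m : nat).
Local Notation T := (torus R m).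

Definition path_connected (X : topologicalType) (A : set X) :=
  forall x y, A x -> A y -> exists c : R -> X,
    [/\ {within `[0, 1], continuous c}, c 0 = x, c 1 = y
      & forall t, `[0, 1]%classic t -> A (c t)].

(* The foliation of dimension d and codimension q whose leaf through x is W x.
   A foliated chart is the inverse of a homeomorphism b from R^d x R^q onto an
   open subset, and the components of the trace of a leaf on range b are the
   plaques b (R^d x {y}). Leaves are required to be path connected because the
   union of two dense leaves is connected in the induced topology. *)
Definition foliation (d q : nat) (W : T -> set T) :=
  [/\ (forall x, W x x),
      (forall x y, W x y -> W y = W x),
      (forall x, path_connected (W x))
    & forall x, exists b : 'rV[R]_d * 'rV[R]_q -> T,
        [/\ continuous b /\ injective b,
            (forall O, open O -> open (b @` O)),
            range b x
          & (forall u y, connected_component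
               (W (b (u, y)) `&` range b) (b (u, y)) =
               [set b (u', y) | u' in setT])]].

(* The leaf topology makes every leaf a connected immersed submanifold. *)
Definition foliation_tangent_to (d q : nat) (W : T -> set T)
    (B : T -> {vspace 'rV[R]_m}) :=
  foliation d q W /\
  forall x, exists (S : topologicalType) (iota : S -> T),
    [/\ immersed_submanifold d iota, connected [set: S],
        tangent_to d iota B & range iota = W x].

Definition invariant_foliation (f : T -> T) (W : T -> set T) :=
  forall x, f @` W x = W (f x).

Definition linear_leaf (L : {vspace 'rV[R]_m}) (p : T) : set T :=
  [set q | exists x v, [/\ tproj x = p, v \in L & tproj (x + v) = q]].

Definition homeomorphism (psi : T -> T) :=
  exists psi' : T -> T,
    [/\ cancel psi psi', cancel psi' psi, continuous psi & continuous psi'].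

(* The invariant splitting of a partially hyperbolic toral automorphism is
   constant, given by the linear subspaces Ls, Lc and Lu. *)
Definition leaf_conjugate_to_linear_part (f : T -> T) (W : T -> set T) :=
  exists A : 'M[int]_m, linear_part f A /\
  exists Ls Lc Lu : {vspace 'rV[R]_m},
    [/\ partially_hyperbolic (toral_map A)
          (fun=> Ls) (fun=> Lc) (fun=> Lu),
        \dim Ls = 1%N, \dim Lc = 1%N
      & exists psi : T -> T,
        [/\ homeomorphism psi,
            (forall x, psi @` W x = linear_leaf Lc (psi x))
          & (forall x, psi @` (f @` W x) = toral_map A @` (psi @` W x))]].

End Foliations.

(* Main.v *)
(* Work in the universal cover.  Let K be the preimage of T, and let psi be a
   lift of the leaf conjugacy, so that the lifted center leaves are the preimages
   under psi of the lines parallel to Lc.  Suppose that K contains a leaf L.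

   Near a point p0 of K, let y be a point with the same stable coordinate of psi
   as L.  Moving from y along Es one reaches K at a point y' whose forward orbit
   stays close to that of y, so psi y and psi y' have the same unstable
   coordinate.  Moving from y' along Eu inside K, which is tangent to Ec + Eu,
   one reaches L, and the backward orbits stay close, so psi y' has the same
   stable coordinate as L and y.  Hence y and y' lie on one leaf, which is
   transverse to Es, and y = y' belongs to K.  Unique integrability is never
   used: instead of integral curves one minimises a penalised distance.

   Thus K contains all points whose image under psi lies in a fixed translate of
   Lc + Lu.  Such a translate is dense modulo the lattice, since the stable
   coordinates of the images of an integer vector under the linear part tend to 0.
   So K is everything, while it cannot contain two nearby points on a line
   parallel to Es. *)
Require Import Defs.
From mathcomp Require Import all_boot all_order all_algebra.
From mathcomp Require Import all_classical all_reals all_analysis.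
From mathcomp Require Import generic_quotient lra ring.

Set Implicit Arguments.
Unset Strict Implicit.
Unset Printing Implicit Defensive.

Import Order.TTheory GRing.Theory Num.Theory.
Import numFieldNormedType.Exports.

Local Open Scope classical_set_scope.
Local Open Scope ring_scope.

(** The penalty in [descent] includes the displacement of the j-th iterate. The derivatives of all
    forward iterates on [Es], and of all backward iterates on [Eu], share one bound, so first-order
    moves along the bundle cost little: the minimiser closes the gap while its j-th iterate moves by
    a small amount, uniformly in j. This does the work of the length estimate for the image of a
    stable or unstable curve. The point found depends on j, and for the stable move compactness is
    needed to get one point out of all j.

    The leaf conjugacy sends leaves to leaves without matching the dynamics inside a leaf, so its
    lift is equivariant only modulo [Lc]. Hence only the stable and unstable coordinates of
    differences carry information. Points agreeing in both lie on one lifted leaf but could still be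
    distinct, which is why a leaf must be shown transverse to [Es].

    The projection of the integer lattice along [Lc] may be dense, so discreteness arguments fail
    for it. Countability takes their place: a continuous path with values in a countable set is
    constant. *)

Ltac drop_ineqs := repeat match goal with H : is_true _ |- _ => clear H end.

(** * Tangent curves and descent *)

Section Euclidean.
Variable R : realType.

Lemma le_coord (m : nat) (v : 'rV[R]_m) k : `|v ord0 k| <= `|v|.
Proof.
rewrite [leRHS]mx_normrE.
exact: (le_bigmax _ (fun ij => `|v ij.1 ij.2|) (ord0, k)).
Qed.

Lemma lfun_bound (m p : nat) (M : 'Hom('rV[R]_m, 'rV[R]_p)) :
  exists2 C, 0 < C & forall v, `|M v| <= C * `|v|.
Proof.
exists (1 + \sum_j `|M (delta_mx ord0 j)|).
  by rewrite ltr_pwDl// sumr_ge0.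
move=> v; rewrite [in leLHS](row_sum_delta v) linear_sum/=.
rewrite (le_trans (ler_norm_sum _ _ _))// mulrDl mul1r mulr_suml.
rewrite ler_wpDl// ler_sum// => j _; rewrite linearZ/= normrZ mulrC.
by rewrite ler_wpM2l// le_coord.
Qed.

Lemma continuous_norm_sub (T : topologicalType) (V : normedModType R)
    (f : T -> V) (b : V) : continuous f -> continuous (fun x => `|f x - b|).
Proof.
move=> cf x; apply: cvg_norm; apply: cvgB; [exact: cf|exact: cvg_cst].
Qed.

Lemma closed_le_fun (T : topologicalType) (f g : T -> R) :
  continuous f -> continuous g -> closed [set x | f x <= g x].
Proof.
move=> cf cg; have -> : [set x | f x <= g x] = (f \- g) @^-1` [set z | z <= 0].
  by apply/seteqP; split=> x /=; rewrite subr_le0.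
apply: preimage_closed; last exact: closed_le.
by move=> x _; apply: cvgB; [exact: cf|exact: cg].
Qed.

Lemma continuous_scale (T : topologicalType) (k : R) (f : T -> R) :
  continuous f -> continuous (fun x => k * f x).
Proof. by move=> cf x; apply: cvgMr; exact: cf. Qed.

Lemma near_dist (m : nat) (x : 'rV[R]_m) e : 0 < e ->
  \forall y \near x, `|y - x| < e.
Proof.
move=> e0; apply/nbhs_normP; exists e => //= y /=.
by rewrite /ball_/= distrC.
Qed.

Lemma continuous_dist (m : nat) (V : normedModType R) (F : 'rV[R]_m -> V) x :
  {for x, continuous F} <->
  forall e, 0 < e -> \forall y \near x, `|F y - F x| <= e.
Proof.
have P := @cvgrPdist_le _ _ _ (nbhs x) (nbhs_filter x) F (F x).
split=> [/P H e /H|H]; last apply/P => e /H.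
  by apply: filterS => y; rewrite distrC.
by apply: filterS => y; rewrite distrC.
Qed.

Lemma continuous_translate (m : nat) (k : 'rV[R]_m) :
  continuous (fun x : 'rV[R]_m => x + k).
Proof.
move=> x; apply/continuous_dist => e e0; near=> y.
rewrite opprD addrACA subrr addr0 ltW//; near: y.
Unshelve. all: by end_near. Qed.

Lemma lfun_continuous (m p : nat) (M : 'Hom('rV[R]_m, 'rV[R]_p)) :
  continuous M.
Proof.
have [C C0 MC] := lfun_bound M.
move=> x; apply/continuous_dist => e e0; near=> y.
rewrite -linearB (le_trans (MC _))// -ler_pdivlMl// ltW//; near: y.
by apply: near_dist; rewrite mulr_gt0// invr_gt0.
Unshelve. all: by end_near. Qed.

(** A one-sided expansion at 0, with no demand on [c 0] or on regularity at positive times: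
    [descent] evaluates such a curve at a single small time, where it only has to stay in a
    prescribed set. *)
Definition tangent_curve (m : nat) (c : R -> 'rV[R]_m) (x e : 'rV[R]_m) :=
  forall eps, 0 < eps -> \forall t \near 0^'+, `|c t - x - t *: e| <= eps * t.

Lemma tangent_curve_line (m : nat) (x e : 'rV[R]_m) :
  tangent_curve (fun t => x + t *: e) x e.
Proof.
move=> eps eps0; near=> t.
by rewrite [x + _]addrC addrK subrr normr0 mulr_ge0// ltW.
Unshelve. all: by end_near. Qed.

Lemma tangent_curve_cvg (m : nat) (c : R -> 'rV[R]_m) (x e : 'rV[R]_m) :
  tangent_curve c x e -> c t @[t --> 0^'+] --> x.
Proof.
move=> ce; apply/cvgrPdist_le => eps eps0; near=> t.
have t0 : 0 < t by [].
have -> : x - c t = - ((c t - x - t *: e) + t *: e) by rewrite subrK opprB.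
rewrite normrN (le_trans (ler_normD _ _))//.
have /ler_wpDr : `|c t - x - t *: e| <= 1 * t by near: t; exact: ce.
rewrite mul1r normrZ gtr0_norm// => ct.
apply: (@le_trans _ _ (t * (1 + `|e|))).
  by rewrite mulrDr mulr1 lerD2r -[t in leRHS]addr0 ct.
rewrite -ler_pdivlMr ?ltr_pwDl//; near: t.
by apply: nbhs_right_le; rewrite divr_gt0// ltr_pwDl.
Unshelve. all: by end_near. Qed.

Lemma tangent_curve_near (m : nat) (c : R -> 'rV[R]_m) (x e : 'rV[R]_m)
    (P : set 'rV[R]_m) :
  tangent_curve c x e -> (\forall y \near x, P y) -> \forall t \near 0^'+, P (c t).
Proof. by move=> /tangent_curve_cvg; exact. Qed.

Lemma differentiable_approx (m p : nat) (F : 'rV[R]_m -> 'rV[R]_p)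
    (x : 'rV[R]_m) : differentiable F x -> forall eps, 0 < eps ->
  \forall y \near x, `|F y - F x - 'd F x (y - x)| <= eps * `|y - x|.
Proof.
move=> dF eps eps0.
have /eqaddoP/(_ _ eps0) := diff_locally dF.
rewrite nearE => H; rewrite [\forall y \near x, _](near_shift 0 x); near=> y.
have := near H y; rewrite /= => /(_ _) H'.
rewrite /= subr0 addrK -addrA -opprD.
by near: y; apply: filterS H => y.
Unshelve. all: by end_near. Qed.

Lemma diff_bound (m p : nat) (F : 'rV[R]_m -> 'rV[R]_p) x :
  exists2 C, 0 < C & forall v, `|'d F x v| <= C * `|v|.
Proof.
have [C C0 H] := lfun_bound (linfun ('d F x)).
by exists C => // v; have := H v; rewrite lfunE.
Qed.

Lemma tangent_curve_comp (m p : nat) (F : 'rV[R]_m -> 'rV[R]_p)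
    (c : R -> 'rV[R]_m) (x e : 'rV[R]_m) :
  differentiable F x -> tangent_curve c x e ->
  tangent_curve (F \o c) (F x) ('d F x e).
Proof.
move=> dF ce eps eps0.
have [C C0 HC] := diff_bound F x.
(* Half of [eps] pays for linearising [F] over a displacement of at most [t * (1 + |e|)], the other
   half for ['d F x] applied to the error of the curve. The bound 1 in [e2] gives that displacement
   estimate. *)
pose e1 := eps / 2 / (1 + `|e|); have e10 : 0 < e1.
  by rewrite !divr_gt0// ltr_pwDl.
pose e2 := Num.min 1 (eps / 2 / C); have e20 : 0 < e2.
  by rewrite lt_min ltr01 !divr_gt0.
near=> t; have t0 : 0 < t by [].
have cE : c t - x = (c t - x - t *: e) + t *: e by rewrite subrK.
have ct : `|c t - x - t *: e| <= e2 * t by near: t; exact: ce.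
have cn : `|c t - x| <= t * (1 + `|e|).
  rewrite cE (le_trans (ler_normD _ _))// normrZ gtr0_norm// mulrDr mulr1.
  rewrite lerD2r (le_trans ct)// -[leRHS]mul1r ler_wpM2r ?(ltW t0)//.
  by rewrite /e2 ge_min lexx.
have H : `|F (c t) - F x - 'd F x (c t - x)| <= e1 * `|c t - x|.
  near: t; apply: (tangent_curve_near (P := fun y =>
    `|F y - F x - 'd F x (y - x)| <= e1 * `|y - x|) ce).
  exact: differentiable_approx.
rewrite /=; have -> : F (c t) - F x - t *: 'd F x e =
    (F (c t) - F x - 'd F x (c t - x)) + 'd F x (c t - x - t *: e).
  by rewrite (linearB _ (c t - x) (t *: e))/= -linearZ/= [RHS]addrA subrK.
rewrite (le_trans (ler_normD _ _))// [eps in leRHS]splitr mulrDl lerD//.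
  rewrite (le_trans H)// (le_trans (ler_wpM2l (ltW e10) cn))//.
  have e1E : e1 * (1 + `|e|) = eps / 2 by rewrite divfK// gt_eqF// ltr_pwDl.
  by rewrite mulrCA e1E mulrC.
rewrite (le_trans (HC _))// (le_trans (ler_wpM2l (ltW C0) ct))//.
rewrite mulrA ler_wpM2r ?(ltW t0)// mulrC -ler_pdivlMr//.
by rewrite /e2 ge_min lexx orbT.
Unshelve. all: by end_near. Qed.

End Euclidean.

Section Descent.
Variable R : realType.

Lemma tangent_dist (V : normedModType R) (x c y e : V) (t eps : R) :
  0 <= t -> `|c - x - t *: e| <= eps * t ->
  `|c - y| <= `|x - y| + t * `|e| + eps * t.
Proof.
move=> t0 H; have -> : c - y = (x - y) + t *: e + (c - x - t *: e).
  by rewrite -addrA [t *: e + _]addrC subrK [RHS]addrC [RHS]addrA subrK.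
rewrite (le_trans (ler_normD _ _))// lerD// (le_trans (ler_normD _ _))//.
by rewrite normrZ ger0_norm.
Qed.

(* Ekeland-type argument: at a minimum of the penalised distance, the assumed
   direction would decrease it to first order unless [M (x - z) = 0]. *)
Lemma descent (m : nat) (X Z : set 'rV[R]_m) (F : 'rV[R]_m -> 'rV[R]_m)
    (M Q : 'End('rV[R]_m)) (a b : R) (y z0 : 'rV[R]_m) :
  compact X -> compact Z -> X y -> Z z0 -> continuous F -> 0 < a -> 0 <= b ->
  (forall x z, X x -> Z z -> M (x - z) != 0 ->
     a * `|x - y| <= `|M (y - z0)| -> a * `|z - z0| <= `|M (y - z0)| ->
     exists cx cz e1 e2 e3,
       [/\ tangent_curve cx x e1, tangent_curve cz z e2,
           tangent_curve (F \o cx) (F x) e3,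
           \forall t \near 0^'+, X (cx t) /\ Z (cz t) &
           `|M (x - z) + M (e1 - e2)| + a * (`|e3| + `|e1| + `|e2|)
             + b * `|Q e1| < `|M (x - z)|]) ->
  exists x z,
    [/\ X x, Z z, M (x - z) = 0,
        a * (`|F x - F y| + `|x - y| + `|z - z0|) + b * `|Q (x - y)|
          <= `|M (y - z0)| &
        a * (`|F x - F y| + `|x - y|) + b * `|Q (x - y)| <= `|M (y - z)|].
Proof.
move=> cX cZ Xy Zz0 cF a0 b0 H.
pose Phi (u : 'rV[R]_m * 'rV[R]_m) : R := `|M (u.1 - u.2)|
  + a * (`|F u.1 - F y| + `|u.1 - y| + `|u.2 - z0|) + b * `|Q (u.1 - y)|.
have cPhi : continuous Phi.
  move=> u; have c1 : fst v @[v --> u] --> u.1 by exact: cvg_fst.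
  have c2 : snd v @[v --> u] --> u.2 by exact: cvg_snd.
  apply: cvgD; first apply: cvgD.
  - apply: cvg_norm; apply: (cvg_comp _ _ (cvgB c1 c2)).
    exact: lfun_continuous.
  - apply: cvgMr; apply: cvgD; first apply: cvgD.
    + apply: cvg_norm; apply: cvgB; last exact: cvg_cst.
      exact: (cvg_comp _ _ c1 (cF _)).
    + apply: cvg_norm; apply: cvgB; last exact: cvg_cst.
      exact: c1.
    + apply: cvg_norm; apply: cvgB; last exact: cvg_cst.
      exact: c2.
  - apply: cvgMr; apply: cvg_norm.
    apply: (cvg_comp _ _ (cvgB c1 (cvg_cst y))).
    exact: lfun_continuous.
have [[x z]] : exists2 u, u \in X `*` Z & forall v, v \in X `*` Z -> Phi u <= Phi v.
  apply: compact_EVT_min; [by exists (y, z0)|exact: compact_setX|].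
  exact: continuous_subspaceT.
rewrite inE => -[/= Xx Zz] xzmin.
have Phimin v w : X v -> Z w -> Phi (x, z) <= Phi (v, w).
  by move=> Xv Zw; apply: xzmin; rewrite inE.
have Phi0 w : Phi (y, w) = `|M (y - w)| + a * `|w - z0|.
  by rewrite /Phi/= !subrr linear0 !normr0 mulr0 addr0 !add0r.
(* Comparison of the minimum with [(y, z0)] gives the first estimate of the conclusion. Comparison
   with [(y, z)], where the penalty on [z] cancels, gives the second. *)
have := Phimin y z0 Xy Zz0; rewrite Phi0 subrr normr0 mulr0 addr0 => le1.
have := Phimin y z Xy Zz; rewrite Phi0 => le2.
have aF := mulr_ge0 (ltW a0) (normr_ge0 (F x - F y)).
have ax := mulr_ge0 (ltW a0) (normr_ge0 (x - y)).
have az := mulr_ge0 (ltW a0) (normr_ge0 (z - z0)).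
have bQ := mulr_ge0 b0 (normr_ge0 (Q (x - y))).
have Mn := normr_ge0 (M (x - z)).
have M0 : M (x - z) = 0; last first.
  exists x, z; split => //; move: le1 le2; rewrite /Phi/= M0 normr0;
    rewrite !mulrDr; lra.
apply/eqP/negPn/negP => Mneq0.
have [||cx [cz [e1 [e2 [e3 [te1 te2 te3 XZ gap]]]]]] := H x z Xx Zz Mneq0.
- by move: le1; rewrite /Phi/= !mulrDr; lra.
- by move: le1; rewrite /Phi/= !mulrDr; lra.
set g := `|M (x - z)| - (`|M (x - z) + M (e1 - e2)|
  + a * (`|e3| + `|e1| + `|e2|) + b * `|Q e1|).
have g0 : 0 < g by rewrite subr_gt0.
have [CM CM0 HM] := lfun_bound M; have [CQ CQ0 HQ] := lfun_bound Q.
(* The coefficient of [eps * t] in the total error: two curves seen through [M], three distances of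
   weight [a], one [Q] term of weight [b]. With [eps = g / 2 / D] the error is half of the
   first-order gain [t * g]. *)
pose D := 2 * CM + 3 * a + b * CQ.
have D0 : 0 < D.
  by rewrite ltr_wpDr ?mulr_ge0// ?(ltW CQ0)// addr_gt0// mulr_gt0.
pose eps := g / 2 / D; have eps0 : 0 < eps by rewrite !divr_gt0.
have [t [t01 XZt c1 c2 c3]] : exists t, [/\ 0 < t < 1, X (cx t) /\ Z (cz t),
   `|cx t - x - t *: e1| <= eps * t, `|cz t - z - t *: e2| <= eps * t &
   `|F (cx t) - F x - t *: e3| <= eps * t].
  near (0 : R)^'+ => t; exists t; split.
  - by apply/andP; split; near: t; [exact: nbhs_right_gt|exact: nbhs_right_lt].
  - by near: t.
  - by near: t; exact: te1.
  - by near: t; exact: te2.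
  - by near: t; exact: te3.
case/andP: t01 => t0 t1; case: XZt => Xt Zt.
have := Phimin _ _ Xt Zt; rewrite /Phi/=.
have d1 := tangent_dist y (ltW t0) c1.
have d2 := tangent_dist z0 (ltW t0) c2.
have d3 := tangent_dist (F y) (ltW t0) c3.
have dQ : `|Q (cx t - y)| <= `|Q (x - y)| + t * `|Q e1| + CQ * eps * t.
  rewrite [Q (cx t - y)]linearB/= [Q (x - y)]linearB/=.
  apply: tangent_dist; first exact: ltW.
  rewrite -linearB/= -linearZ/= -linearB/= (le_trans (HQ _))// -mulrA.
  by rewrite ler_wpM2l// ltW.
have dM : `|M (cx t - cz t)| <= (1 - t) * `|M (x - z)|
    + t * `|M (x - z) + M (e1 - e2)| + CM * (2 * eps * t).
  (* A convex combination plus an error: this turns the assumed inequality at time 1 into a decrease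
     proportional to [t], and so replaces differentiating the norm. *)
  have -> : M (cx t - cz t) = (1 - t) *: M (x - z)
    + t *: (M (x - z) + M (e1 - e2))
    + M ((cx t - x - t *: e1) - (cz t - z - t *: e2)).
    rewrite -linearD/= -!linearZ/= -!linearD/=; congr (M _).
    apply/rowP => i; rewrite !mxE; ring.
  rewrite (le_trans (ler_normD _ _))// lerD//.
    rewrite (le_trans (ler_normD _ _))// !normrZ gtr0_norm ?subr_gt0//.
    by rewrite (gtr0_norm t0).
  rewrite (le_trans (HM _))// ler_wpM2l ?(ltW CM0)//.
  by rewrite (le_trans (ler_normB _ _))//; move: c1 c2; lra.
have := ler_wpM2l (ltW a0) d1; have := ler_wpM2l (ltW a0) d2.
have := ler_wpM2l (ltW a0) d3; have := ler_wpM2l b0 dQ.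
have tg : 0 < t * g by rewrite mulr_gt0.
have epsE : eps * D * t = t * g / 2.
  by rewrite /eps divfK ?gt_eqF// mulrC mulrA.
by move: tg epsE dM; rewrite /g /D; lra.
Unshelve. all: by end_near. Qed.

End Descent.

Section Splitting.
Variables (R : realType) (m : nat).
Local Notation E := 'rV[R]_m.

Definition projections (U V W : {vspace E}) (pU pV pW : 'End(E)) :=
  [/\ (forall v, [/\ pU v \in U, pV v \in V & pW v \in W]),
      (forall v, pU v + pV v + pW v = v),
      (forall u, u \in U -> [/\ pU u = u, pV u = 0 & pW u = 0]),
      (forall v, v \in V -> [/\ pU v = 0, pV v = v & pW v = 0]) &
      (forall w, w \in W -> [/\ pU w = 0, pV w = 0 & pW w = w])].

Lemma projections_exist (U V W : {vspace E}) :
  (U + V + W)%VS = fullv -> directv (U + V + W) ->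
  exists pU pV pW, projections U V W pU pV pW.
Proof.
move=> full; rewrite directv_addE /= => /and3P[].
move=> /directv_addP UV0 _ /eqP UVW0.
have WUV0 : (W :&: (U + V) = 0)%VS by rewrite capvC.
have VU0 : (V :&: U = 0)%VS by rewrite capvC.
pose q := daddv_pi (U + V) W.
have qE v : q v \in (U + V)%VS by exact: memv_pi.
have qid v : v \in (U + V)%VS -> q v = v by exact: daddv_pi_id.
have sum v : q v + daddv_pi W (U + V) v = v.
  by rewrite daddv_pi_add// full memvf.
have W0 v : v \in (U + V)%VS -> daddv_pi W (U + V) v = 0.
  by move=> /qid qv; have := sum v; rewrite qv => /eqP; rewrite addrC -subr_eq0 addrK => /eqP.
have q0 w : w \in W -> q w = 0.
  move=> /(daddv_pi_id WUV0) ww; have := sum w; rewrite ww => /eqP.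
  by rewrite -subr_eq0 addrK => /eqP.
have sumUV v : v \in (U + V)%VS -> daddv_pi U V v + daddv_pi V U v = v.
  by move=> vUV; rewrite daddv_pi_add.
exists (daddv_pi U V \o q)%VF, (daddv_pi V U \o q)%VF, (daddv_pi W (U + V)).
split=> [v|v|u uU|v vV|w wW]; rewrite ?comp_lfunE.
- by rewrite !memv_pi.
- by rewrite sumUV.
- have uUV : u \in (U + V)%VS by rewrite (subvP (addvSl U V)).
  rewrite qid// (W0 _ uUV) (daddv_pi_id UV0)//; split => //.
  have := sumUV u uUV; rewrite daddv_pi_id// => /eqP.
  by rewrite addrC -subr_eq0 addrK => /eqP.
- have vUV : v \in (U + V)%VS by rewrite (subvP (addvSr U V)).
  rewrite qid// (W0 _ vUV) (daddv_pi_id VU0)//; split => //.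
  have := sumUV v vUV; rewrite (daddv_pi_id VU0)// => /eqP.
  by rewrite -subr_eq0 addrK => /eqP.
- by rewrite q0// !linear0 daddv_pi_id.
Qed.

(** Directions are chosen at a fixed point by constant projections and then moved into the bundle at
    nearby points, which calls for this half of continuity. The error is relative to [|e0|], so that
    one neighbourhood serves all vectors. *)
Definition bundle_lsc (B : E -> {vspace E}) (x0 : E) :=
  forall eps, 0 < eps -> \forall x \near x0, forall e0, e0 \in B x0 ->
    exists2 e, e \in B x & `|e - e0| <= eps * `|e0|.

Lemma near_radius (x : E) (P : set E) : (\forall y \near x, P y) ->
  exists2 r, 0 < r & forall y, `|y - x| <= r -> P y.
Proof.
move=> /nbhs_normP[r /= r0 rP]; exists (r / 2); first by rewrite divr_gt0.
move=> y yr; apply: rP; rewrite /ball_/= distrC (le_lt_trans yr)//.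
by rewrite gtr_pMr// invf_lt1// ltr1n.
Qed.

Lemma compact_closed_ball (p : E) (r : R) (A : set E) : closed A ->
  compact (A `&` [set x | `|x - p| <= r]).
Proof.
move=> cA; apply: bounded_closed_compact.
  exists (r + `|p|); split; first by rewrite num_real.
  move=> M rM x [_ /= xr]; rewrite -(subrK p x).
  by rewrite (le_trans (ler_normD _ _))// (le_trans _ (ltW rM))// lerD2r.
apply: closedI => //.
apply: (@preimage_closed E R (fun x => `|x - p|) [set z | z <= r]).
  move=> x _; apply: (@continuous_norm_sub _ E E id p).
  by move=> z; exact: cvg_id.
exact: closed_le.
Qed.

Lemma lfun_bound3 (ps pc pu : 'End(E)) : exists2 C1, 1 <= C1 &
  forall v, [/\ `|ps v| <= C1 * `|v|, `|pc v| <= C1 * `|v| &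
                `|pu v| <= C1 * `|v|].
Proof.
have [c1 c10 h1] := lfun_bound ps; have [c2 c20 h2] := lfun_bound pc.
have [c3 c30 h3] := lfun_bound pu.
exists (1 + c1 + c2 + c3); first lra.
have le (v : E) (c : R) : c <= 1 + c1 + c2 + c3 ->
    c * `|v| <= (1 + c1 + c2 + c3) * `|v| by move=> h; rewrite ler_wpM2r.
move=> v; split.
- by rewrite (le_trans (h1 v))// le//; lra.
- by rewrite (le_trans (h2 v))// le//; lra.
- by rewrite (le_trans (h3 v))// le//; lra.
Qed.

(* If [psi] lifts a homeomorphism conjugating a foliation to the linear
   foliation by [L], this is the lift through [p] of its leaf. *)
Definition leaf (psi : E -> E) (L : {vspace E}) (p : E) :=
  [set z | psi z - psi p \in L].

Definition int_vector (k : E) := forall i, k ord0 i \is a Num.int.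

Lemma int_vector_cube (x : E) : exists2 k, int_vector k & `|x + k| <= 1.
Proof.
exists (\row_i (- (Num.floor (x ord0 i))%:~R)).
  by move=> i; rewrite mxE rpredN intr_int.
rewrite [leLHS]mx_normrE; apply/bigmax_leP; split => //= -[i j] _ /=.
rewrite !mxE (ord1 i); have /andP[h1 h2] := floor_itv (x ord0 j).
by rewrite ger0_norm ?subr_ge0// lerBlDl ltW// -[1 in X in _ < X]/(1%:~R) -intrD.
Qed.

End Splitting.

(** * Transversality of lifted leaves to the stable direction *)

Section LeafTransverse.
Variables (R : realType) (m : nat).
Local Notation E := 'rV[R]_m.

(** The norm is the maximum of the absolute coordinates, so the coordinate that is largest for a
    generator attains it on the whole line. The norm on the line is thus a linear functional up to
    sign. *)
Lemma line_coordinate (U : {vspace E}) : \dim U = 1%N ->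
  exists i, forall w, w \in U -> `|w ord0 i| = `|w|.
Proof.
move=> /eqP dU.
have U0 : U != 0%VS by rewrite -dimv_eq0 (eqP dU).
have b0 : vpick U != 0 by rewrite vpick0.
have UE : U = <[vpick U]>%VS.
  apply/esym/eqP; rewrite eqEdim -memvE memv_pick (eqP dU) dim_vline b0.
  by [].
have : mx_norm (vpick U) != 0 by rewrite -[mx_norm _]/`|vpick U| normr_eq0.
move=> /mx_norm_neq0[[i j]] /= bij.
exists j => w; rewrite UE => /vlineP[k ->].
by rewrite mxE normrM normrZ; congr (_ * _); rewrite [RHS]bij (ord1 i).
Qed.

Variables (Es Ec Eu : E -> {vspace E}) (psi psi' : E -> E) (Lc : {vspace E}).
Local Notation leaf := (leaf psi Lc).
Hypothesis Ec_lsc : forall x, bundle_lsc Ec x.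
Hypothesis Es_dim : forall x, \dim (Es x) = 1%N.
Hypothesis Ec_dim : forall x, \dim (Ec x) = 1%N.
Hypothesis psiK : cancel psi psi'.
Hypothesis psi'K : cancel psi' psi.
Hypothesis psi_cont : continuous psi.
Hypothesis psi'_cont : continuous psi'.
Hypothesis Lc_dim : \dim Lc = 1%N.
Hypothesis leaf_tangent : forall z e, e \in Ec z ->
  exists2 c, tangent_curve c z e & \forall t \near 0^'+, leaf z (c t).

(* Rolle's theorem along the leaf, applied to a functional that vanishes on
   [y' - y]. *)
Lemma leaf_transverse p0 ps pc pu :
  projections (Es p0) (Ec p0) (Eu p0) ps pc pu ->
  exists2 r0, 0 < r0 & forall y y', `|y - p0| < r0 -> `|y' - p0| < r0 ->
    leaf y y' -> `|(\1 - ps)%VF (y' - y)| <= 2^-1 * `|y' - y| -> y' = y.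
Proof.
move=> Pr; have [C1 C1ge HC1] := lfun_bound3 ps pc pu; have C1gt : 0 < C1 by lra.
set Q := (\1 - ps)%VF.
have QE v : Q v = v - ps v by rewrite !lfunE/= !lfunE.
have CC : C1 <= C1 * C1 by rewrite ler_peMl// ltW.
pose eps := (4 * (C1 * C1))^-1; have CC0 : 0 < C1 * C1 by rewrite mulr_gt0.
have eps0 : 0 < eps by rewrite invr_gt0; lra.
have eCC : eps * (C1 * C1) = 4^-1 by rewrite /eps; field; rewrite gt_eqF.
have eC : eps * C1 <= 4^-1 by rewrite -eCC ler_wpM2l// ltW.
have [rho rho0 near1] := near_radius (Ec_lsc p0 eps0).
have [eta eta0 Heta] : exists2 eta, 0 < eta & forall w : E, `|w - psi p0| <= eta ->
    `|psi' w - p0| <= rho.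
  have := (continuous_dist psi' (psi p0)).1 (@psi'_cont (psi p0)) rho rho0.
  by rewrite psiK; exact: near_radius.
have [r0 r00 Hr0] : exists2 r0, 0 < r0 & forall x : E, `|x - p0| <= r0 ->
    `|psi x - psi p0| <= eta.
  exact: near_radius ((continuous_dist psi p0).1 (@psi_cont p0) eta eta0).
exists r0 => // y y' yp0 y'p0 lyy' Qr; apply/eqP/negPn/negP => yy'.
have [r rE] : exists r, r = y' - y by exists (y' - y).
rewrite -rE in Qr; have r_neq0 : r != 0 by rewrite rE subr_eq0.
have r_gt0 : 0 < `|r| by rewrite normr_gt0.
have [i iP] := line_coordinate (Es_dim p0).
have [j jP] := line_coordinate (Ec_dim p0).
case: (Pr) => mem sum ids idc idu.
have [sr cr ur] := mem r.
(* The 2 by 2 determinant of the center and stable coordinates of [v] and [r], where [j] and [i]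
   read off the norms on [Ec p0] and [Es p0]. It vanishes at [r]; as [r] lies in a cone about
   [Es p0], it does not vanish on directions close to [Ec p0]. *)
pose al (v : E) : R := (pc v) ord0 j * (ps r) ord0 i - (pc r) ord0 j * (ps v) ord0 i.
have alD v w : al (v + w) = al v + al w.
  by rewrite /al !linearD/= !mxE; ring.
have alZ k v : al (k *: v) = k * al v.
  have lZ (q : 'End(E)) : q (k *: v) = k *: q v by exact: linearZ.
  by rewrite /al !lZ !mxE; ring.
have alr : al r = 0 by rewrite /al mulrC subrr.
have alB v : `|al v| <= 2 * C1 * C1 * `|r| * `|v|.
  have [b1 b2 _] := HC1 v; have [b3 b4 _] := HC1 r.
  rewrite /al (le_trans (ler_normB _ _))// !normrM.
  have -> : 2 * C1 * C1 * `|r| * `|v| =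
    (C1 * `|v|) * (C1 * `|r|) + (C1 * `|r|) * (C1 * `|v|) by ring.
  by rewrite lerD// ler_pM// (le_trans (le_coord _ _)).
have Dal0 : 0 < 2 * C1 * C1 * `|r| by rewrite !mulr_gt0.
pose D := psi y' - psi y.
have D0 : D != 0 by rewrite subr_eq0 (can_eq psiK).
have LcD v : v \in Lc -> exists k, v = k *: D.
  have -> : Lc = <[D]>%VS; last by move=> /vlineP.
  by apply/esym/eqP; rewrite eqEdim -memvE lyy' dim_vline D0 Lc_dim.
(* [D] generates the line [Lc], so [ga] runs through the lifted leaf from [y] to [y']. It is merely
   continuous; tangency to [Ec] enters only through [leaf_tangent]. *)
pose ga (t : R) := psi' (psi y + t *: D).
have ga0 : ga 0 = y by rewrite /ga scale0r addr0 psiK.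
have ga1 : ga 1 = y' by rewrite /ga scale1r addrC subrK psiK.
have ga_rho t : 0 <= t <= 1 -> `|ga t - p0| <= rho.
  move=> /andP[t0 t1]; apply: Heta.
  have -> : psi y + t *: D - psi p0 =
      (1 - t) *: (psi y - psi p0) + t *: (psi y' - psi p0).
    by apply/rowP => k; rewrite !mxE; ring.
  rewrite (le_trans (ler_normD _ _))// !normrZ !ger0_norm ?subr_ge0//.
  have h1 : (1 - t) * `|psi y - psi p0| <= (1 - t) * eta.
    by rewrite ler_wpM2l ?subr_ge0// Hr0// ltW.
  have h2 : t * `|psi y' - psi p0| <= t * eta.
    by rewrite ler_wpM2l// Hr0// ltW.
  move: h1 h2; drop_ineqs; lra.
have ga_cont : continuous ga.
  have lin_cont : continuous (fun t : R => psi y + t *: D).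
    by move=> t; apply: cvgD; [exact: cvg_cst|exact: scalel_continuous].
  have -> : ga = psi' \o (fun t : R => psi y + t *: D) by [].
  by move=> t; apply: continuous_comp; [exact: lin_cont|exact: psi'_cont].
have phi_cont : continuous (al \o ga).
  move=> t; apply: continuous_comp; first exact: ga_cont.
  apply/continuous_dist => e e0; near=> w.
  have -> : al w - al (ga t) = al (w - ga t).
    by have := alD (w - ga t) (ga t); rewrite subrK => ->; rewrite addrK.
  rewrite (le_trans (alB _))// -ler_pdivlMl// ltW//; near: w.
  by apply: near_dist; rewrite mulr_gt0// invr_gt0.
(* No interior parameter is an extremum of [al] along the leaf: [s = 1] excludes maxima and [s = -1]
   minima. *)
have inner (t s : R) : 0 < t < 1 -> s ^+ 2 = 1 ->
    exists2 t', 0 <= t' <= 1 & s * al (ga t) < s * al (ga t').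
  move=> /andP[t0 t1] s2.
  have trho : `|ga t - p0| <= rho by apply: ga_rho; rewrite !ltW.
  have He := near1 _ trho.
  have [e0 e0c e00] : exists2 e0, e0 \in Ec p0 & e0 != 0.
    exists (vpick (Ec p0)); first exact: memv_pick.
    by rewrite vpick0 -dimv_eq0 Ec_dim.
  have [e ee ee0] := He _ e0c.
  have e0_gt0 : 0 < `|e0| by rewrite normr_gt0.
  (* The product of the center part of [e] and the stable part of [r] is at least
     [3/8 * |r| * |e0|], the other one at most [1/8 * |r| * |e0|], because [eps * C1 ^ 2 = 1/4]. *)
  have ale : al e != 0.
    have [se0 ce0 _] := idc _ e0c.
    have [b1 b2 _] := HC1 (e - e0).
    have cej : `|e0| * (3/4) <= `|pc e ord0 j|.
      have := ler_normD (pc e ord0 j) (- (pc (e - e0) ord0 j)).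
      have := le_coord (pc (e - e0)) j; have := jP _ e0c.
      have -> : pc e ord0 j + - (pc (e - e0) ord0 j) = e0 ord0 j.
        by rewrite linearB/= ce0 !mxE; ring.
      move=> -> h1; rewrite normrN => h2.
      have h3 : C1 * `|e - e0| <= `|e0| / 4.
        have := ler_wpM2l (ltW C1gt) ee0; have := ler_wpM2r (ltW e0_gt0) eC.
        by move: b2; drop_ineqs; lra.
      by move: h1 h2 h3 b2; drop_ineqs; lra.
    have sei : `|ps e ord0 i| <= C1 * (eps * `|e0|).
      have -> : ps e = ps (e - e0) by rewrite linearB/= se0 subr0.
      by rewrite (le_trans (le_coord _ _))// (le_trans b1)// ler_wpM2l// ltW.
    have sri : `|r| / 2 <= `|ps r ord0 i|.
      rewrite iP//; have := ler_normD (Q r) (ps r).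
      by rewrite {1}QE subrK; move: Qr; drop_ineqs; lra.
    have crj : `|pc r ord0 j| <= C1 * (`|r| / 2).
      have -> : pc r = pc (Q r).
        have [_ psr _] := ids _ sr.
        by rewrite QE (linearB pc)/= psr subr0.
      rewrite (le_trans (le_coord _ _))//; have [_ h _] := HC1 (Q r).
      by rewrite (le_trans h)// ler_wpM2l ?(ltW C1gt)//; move: Qr; drop_ineqs; lra.
    rewrite subr_eq0; apply/eqP => /(congr1 Num.norm); rewrite !normrM => E0.
    have q34 : 0 <= 3 / 4 :> R by drop_ineqs; lra.
    have q12 : 0 <= 2^-1 :> R by drop_ineqs; lra.
    have := ler_pM (mulr_ge0 (ltW e0_gt0) _) (mulr_ge0 (ltW r_gt0) _) cej sri.
    rewrite E0 => /(_ q34 q12).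
    have := ler_pM (normr_ge0 _) (normr_ge0 _) crj sei.
    have -> : C1 * (`|r| / 2) * (C1 * (eps * `|e0|)) = `|r| * `|e0| / 8.
      have -> : C1 * (`|r| / 2) * (C1 * (eps * `|e0|)) =
        eps * (C1 * C1) * (`|r| / 2) * `|e0| by ring.
      by rewrite eCC; field.
    have : 0 < `|r| * `|e0| by rewrite mulr_gt0.
    drop_ineqs; lra.
  pose s' := s * Num.sg (al e).
  have s'al : 0 < s * al (s' *: e).
    rewrite alZ /s' !mulrA -expr2 s2 mul1r -normrEsg.
    by rewrite normr_gt0.
  set w := s' *: e in s'al; have we : w \in Ec (ga t) by rewrite memvZ.
  have [c cw cl] := leaf_tangent we.
  set g := s * al w in s'al.
  pose e1 := g / 2 / (2 * C1 * C1 * `|r|).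
  have e10 : 0 < e1 by rewrite !divr_gt0.
  (* A point of the leaf whose image is within [m0] of that of [ga t] is [ga (t + k)] with [t + k]
     still in the unit interval. *)
  pose m0 := Num.min t (1 - t) * `|D|.
  have m00 : 0 < m0 by rewrite mulr_gt0 ?normr_gt0// lt_min t0 subr_gt0.
  have [u [u0 cu lu du]] : exists u, [/\ 0 < u, `|c u - ga t - u *: w| <= e1 * u,
      leaf (ga t) (c u) & `|psi (c u) - psi (ga t)| <= m0].
    near (0 : R)^'+ => u; exists u; split => //.
    - by near: u; exact: cw.
    - by near: u.
    - near: u; apply: (tangent_curve_near
        (P := fun z => `|psi z - psi (ga t)| <= m0) cw).
      exact: (continuous_dist psi (ga t)).1 (@psi_cont (ga t)) m0 m00.
  have [k kD] := LcD _ lu.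
  have kle : `|k| <= Num.min t (1 - t).
    by move: du; rewrite kD normrZ ler_pM2r ?normr_gt0.
  have cuE : c u = ga (t + k).
    rewrite /ga scalerDl addrA -kD.
    have -> : psi y + t *: D = psi (ga t) by rewrite /ga psi'K.
    by rewrite addrC subrK psiK.
  exists (t + k).
    move: kle; rewrite le_min => /andP[]; rewrite !ler_norml.
    by drop_ineqs => /andP[? ?] /andP[? ?]; apply/andP; split; lra.
  rewrite -cuE; have -> : al (c u) =
      al (ga t) + u * al w + al (c u - ga t - u *: w).
    rewrite -alZ -!alD; congr al.
    by apply/rowP => l; rewrite !mxE; ring.
  set rest := al (_ - _ - _).
  have hrest : `|rest| <= u * (g / 2).
    rewrite /rest (le_trans (alB _))//.
    rewrite (le_trans (ler_wpM2l (ltW Dal0) cu))// mulrA [_ * e1]mulrC.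
    by rewrite /e1 divfK ?gt_eqF// mulrC.
  have s1 : `|s| = 1.
    by apply/eqP; rewrite -(@pexpr_eq1 _ _ 2)// -normrX s2 normr1.
  have : `|s * rest| <= u * (g / 2) by rewrite normrM s1 mul1r.
  rewrite ler_norml => /andP[h1 _].
  have ug : 0 < u * g by rewrite mulr_gt0.
  have -> : s * (al (ga t) + u * al w + rest) =
      s * al (ga t) + u * g + s * rest by rewrite /g; ring.
  by move: h1 ug; drop_ineqs; lra.
have endE : al (ga 1) = al (ga 0).
  by rewrite ga0 ga1 -(subrK y y') alD -rE alr add0r.
(* The end values agree, so if no interior point is extremal, maximum and minimum both equal the end
   value. The function is then constant, against [inner] at 1/2. *)
have [tM /[!in_itv]/= tM01 HM] := EVT_max ler01 (continuous_subspaceT phi_cont).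
have [tm /[!in_itv]/= tm01 Hm] := EVT_min ler01 (continuous_subspaceT phi_cont).
have extr (t : R) : 0 <= t <= 1 -> [\/ 0 < t < 1, t = 0 | t = 1].
  move=> /andP[]; rewrite le_eqVlt => /predU1P[<-|t0]; first by constructor 2.
  by rewrite le_eqVlt => /predU1P[->|t1]; [constructor 3|constructor 1; rewrite t0].
have M0 : al (ga tM) = al (ga 0).
  case: (extr _ tM01) => [tMi|->//|->//].
  have [t' t'01] := inner tM 1 tMi (expr1n _ 2).
  by rewrite !mul1r ltNge HM// in_itv/=.
have m0 : al (ga tm) = al (ga 0).
  case: (extr _ tm01) => [tmi|->//|->//].
  have [|t' t'01] := inner tm (-1) tmi; first by rewrite sqrrN expr1n.
  by rewrite !mulN1r ltrN2 ltNge Hm// in_itv/=.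
have half : 0 < (2^-1 : R) < 1 by drop_ineqs; lra.
have [t' t'01] := inner (2^-1) 1 half (expr1n _ 2).
rewrite !mul1r ltNge (@le_trans _ _ (al (ga 0)))//.
  by rewrite -M0 HM// in_itv/=.
by rewrite -m0 Hm// in_itv/= !ltW; case/andP: half.
Unshelve. all: by end_near. Qed.

End LeafTransverse.

(** * Saturation of the submanifold *)

(* [fs j] and [gs j] stand for the iterates of lifts of [f] and its inverse,
   [psi] for a lift of the leaf conjugacy, [qS] and [qU] for the projections
   onto the stable and unstable spaces of the linear part, and [K] for the
   preimage of the submanifold in the universal cover. *)
Section Local.
Variables (R : realType) (m : nat).
Local Notation E := 'rV[R]_m.
Variables (Es Ec Eu : E -> {vspace E}).
Variables (fs gs : nat -> E -> E).
Variables (psi psi' : E -> E) (Lc : {vspace E}) (qS qU : 'End(E)).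
Variable K : set E.

Local Notation leaf := (leaf psi Lc).

Hypothesis fs_diff : forall j x, differentiable (fs j) x.
Hypothesis gs_diff : forall j x, differentiable (gs j) x.
Hypothesis fs_bounded : exists2 C0, 0 < C0 &
  forall j x e, e \in Es x -> `|'d (fs j) x e| <= C0 * `|e|.
Hypothesis gs_bounded : exists2 C0, 0 < C0 &
  forall j x e, e \in Eu x -> `|'d (gs j) x e| <= C0 * `|e|.
Hypothesis Es_lsc : forall x, bundle_lsc Es x.
Hypothesis Ec_lsc : forall x, bundle_lsc Ec x.
Hypothesis Eu_lsc : forall x, bundle_lsc Eu x.
Hypothesis Es_dim : forall x, \dim (Es x) = 1%N.
Hypothesis Ec_dim : forall x, \dim (Ec x) = 1%N.
Hypothesis E_full : forall x, (Es x + Ec x + Eu x)%VS = fullv.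
Hypothesis E_direct : forall x, directv (Es x + Ec x + Eu x).
Hypothesis psiK : cancel psi psi'.
Hypothesis psi'K : cancel psi' psi.
Hypothesis psi_cont : continuous psi.
Hypothesis psi'_cont : continuous psi'.
Hypothesis Lc_dim : \dim Lc = 1%N.
Hypothesis LcP : forall v, (v \in Lc) = (qS v == 0) && (qU v == 0).
Hypothesis fs_psi : forall eps, 0 < eps -> exists j, forall x y,
  `|fs j x - fs j y| <= 1 -> `|qU (psi x - psi y)| <= eps.
Hypothesis gs_psi : forall eps, 0 < eps -> exists j, forall x y,
  `|gs j x - gs j y| <= 1 -> `|qS (psi x - psi y)| <= eps.
Hypothesis K_closed : closed K.
Hypothesis K_tangent : forall k e, K k -> e \in (Ec k + Eu k)%VS ->
  exists2 c, tangent_curve c k e & \forall t \near 0^'+, K (c t).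
Hypothesis K_transverse : forall p0, K p0 -> exists2 rho, 0 < rho &
  forall k k', K k -> K k' -> `|k - p0| <= rho -> `|k' - p0| <= rho ->
    k - k' \in Es p0 -> k = k'.
Hypothesis leaf_tangent : forall z e, e \in Ec z ->
  exists2 c, tangent_curve c z e & \forall t \near 0^'+, leaf z (c t).

Lemma closed_lfun_eq0 (q : 'End(E)) (v : E) :
  closed [set z | q (psi z - v) = 0].
Proof.
have -> : [set z | q (psi z - v) = 0] = [set z | `|q (psi z) - q v| <= 0].
  apply/seteqP; split=> z /=; rewrite -linearB/= normr_le0; first by move=> ->.
  by move/eqP.
apply: (@preimage_closed E R (fun z => `|q (psi z) - q v|) [set z | z <= 0]).
  move=> x _; apply: (@continuous_norm_sub _ E E (q \o psi)) => {}x.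
  by apply: continuous_comp; [exact: psi_cont|exact: lfun_continuous].
exact: closed_le.
Qed.

Lemma bundles_near p0 eps : 0 < eps -> exists2 rho, 0 < rho &
  forall x, `|x - p0| <= rho ->
  [/\ (forall e0, e0 \in Es p0 -> exists2 e, e \in Es x & `|e - e0| <= eps * `|e0|),
      (forall e0, e0 \in Ec p0 -> exists2 e, e \in Ec x & `|e - e0| <= eps * `|e0|) &
      (forall e0, e0 \in Eu p0 -> exists2 e, e \in Eu x & `|e - e0| <= eps * `|e0|)].
Proof.
move=> eps0; apply: near_radius.
by apply: filterS3 (Es_lsc p0 eps0) (Ec_lsc p0 eps0) (Eu_lsc p0 eps0).
Qed.

Lemma near_norm_lt (e : E) (c : R -> E) (x p : E) rho : tangent_curve c x e ->
  `|x - p| < rho -> \forall t \near 0^'+, `|c t - p| <= rho.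
Proof.
move=> ce xp; apply: (tangent_curve_near (P := fun y => `|y - p| <= rho) ce).
near=> y; rewrite -(subrK x y) -addrA (le_trans (ler_normD _ _))//.
rewrite -lerBrDr ltW//; near: y; apply: near_dist.
by rewrite subr_gt0.
Unshelve. all: by end_near. Qed.

Lemma approx_norm (e e0 : E) (eps c : R) : 0 < eps -> eps <= 1 ->
  `|e - e0| <= eps * `|e0| -> `|e0| <= c -> `|e| <= 2 * c /\ `|e - e0| <= eps * c.
Proof.
move=> eps0 eps1 h e0c; have h2 : eps * `|e0| <= eps * c by rewrite ler_wpM2l// ltW.
have h3 : eps * c <= c.
  by rewrite ler_piMl// (le_trans _ e0c)//.
split; last exact: le_trans h2.
have := ler_normD (e - e0) e0; rewrite subrK; lra.
Qed.

(** In [descent], [x] is free in a ball and moves along [Es x], while [z] stays in [K] and moves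
    along [Ec z + Eu z]; together the two directions cancel [x - z] up to small errors. [C] is
    independent of [j] since the derivatives of all [fs j] on [Es] share one bound. The last
    estimate is the cone condition of [leaf_transverse]. *)
Lemma stable_projection p0 ps : K p0 ->
  (exists pc pu, projections (Es p0) (Ec p0) (Eu p0) ps pc pu) ->
  exists r0 C, [/\ 0 < r0, 0 < C & forall y, `|y - p0| < r0 -> forall j,
    exists x, [/\ K x, `|x - y| <= C * `|y - p0|,
      `|fs j x - fs j y| <= C * `|y - p0| &
      `|(\1 - ps)%VF (x - y)| <= 2^-1 * `|x - y|]].
Proof.
move=> Kp0 [pc [pu Pr]]; have [C0 C0_gt0 fs_bound] := fs_bounded.
have [C1 C1ge HC1] := lfun_bound3 ps pc pu; have C1gt : 0 < C1 by lra.
set Q := (\1 - ps)%VF; have [CQ CQ0 HQ] := lfun_bound Q.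
(* The errors of [es], [ec], [eu] and the penalty [2 * |Q es|] together cost [|r| / 4]. With [a]
   below, the displacements cost another [|r| / 4]: [2 * C0] for the image of [es], 2 for [es], 4
   for [ec + eu]. At least half of [|r|] is gained. *)
pose eps := (4 * C1 * (3 + 2 * CQ))^-1.
have den0 : 0 < 4 * C1 * (3 + 2 * CQ) by rewrite !mulr_gt0//; lra.
have eps0 : 0 < eps by rewrite invr_gt0.
have eps1 : eps <= 1.
  rewrite invf_le1//; suff: 1 <= C1 * (3 + 2 * CQ) by lra.
  by rewrite mulr_ege1//; lra.
pose a := (4 * C1 * (2 * C0 + 6))^-1.
have dena0 : 0 < 4 * C1 * (2 * C0 + 6) by rewrite !mulr_gt0//; move: C0_gt0; lra.
have a0 : 0 < a by rewrite invr_gt0.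
have aE t : a * ((2 * C0 + 6) * (C1 * t)) = t / 4.
  by rewrite /a; field; rewrite !gt_eqF//; move: C0_gt0; lra.
have epsE t : (3 + 2 * CQ) * (eps * (C1 * t)) = t / 4.
  by rewrite /eps; field; rewrite !gt_eqF//; lra.
have [rho rho0 near] := bundles_near p0 eps0.
(* The points [x] and [z] to be moved lie within [a^-1 * r0] of [y] and of [p0], hence strictly
   inside the ball of radius [rho], where there is room to move. *)
pose r0 := rho / (2 + a^-1); have ai0 : 0 < a^-1 by rewrite invr_gt0.
have r00 : 0 < r0 by rewrite divr_gt0//; lra.
exists r0, a^-1; split=> // y yp0 j.
have rE : r0 * (2 + a^-1) = rho by rewrite divfK// gt_eqF//; lra.
have rai : 0 < r0 * a^-1 by rewrite mulr_gt0.
have [||||||||x [z [Xx [Kz _] /eqP xz]]] := @descent R m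
    (setT `&` [set x | `|x - p0| <= rho]) (K `&` [set x | `|x - p0| <= rho])
    (fs j) \1%VF Q a 2 y p0.
- by apply: compact_closed_ball; exact: closedT.
- exact: compact_closed_ball.
- by split => //=; lra.
- by split => //=; rewrite subrr normr0 ltW.
- by move=> x; exact: differentiable_continuous.
- by [].
- by [].
- move=> x z [_ /= xrho] [Kz /= zrho]; rewrite !id_lfunE => rneq0 ax az.
  have bnd (w : E) : a * `|w| <= `|y - p0| -> `|w| <= a^-1 * r0.
    by rewrite -ler_pdivlMl// => /le_trans; apply; rewrite ler_wpM2l ?ltW.
  have xlt : `|x - p0| < rho.
    rewrite -(subrK y x) -addrA (le_lt_trans (ler_normD _ _))//.
    by have := bnd _ ax; move: yp0 rE rai r00; drop_ineqs; lra.
  have zlt : `|z - p0| < rho by have := bnd _ az; move: rE rai r00; drop_ineqs; lra.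
  set r := x - z in rneq0 *; have r_gt0 : 0 < `|r| by rewrite normr_gt0.
  case: Pr => mem sum ids idc idu.
  have [ms mc mu] := mem (- r).
  have [bs bc bu] := HC1 (- r); rewrite normrN in bs bc bu.
  have [/(_ _ ms)[es esx es_near] _ _] := near x xrho.
  have [_ /(_ _ mc)[ec ecz ec_near] /(_ _ mu)[eu euz eu_near]] := near z zrho.
  have [es2 {}es_near] := approx_norm eps0 eps1 es_near bs.
  have [ec2 {}ec_near] := approx_norm eps0 eps1 ec_near bc.
  have [eu2 {}eu_near] := approx_norm eps0 eps1 eu_near bu.
  have ecu : - (ec + eu) \in (Ec z + Eu z)%VS by rewrite memvN memv_add.
  have [cz cze czK] := K_tangent Kz ecu.
  exists (fun t => x + t *: es), cz, es, (- (ec + eu)), ('d (fs j) x es).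
  have cxe := tangent_curve_line x es.
  split => //.
  + exact: tangent_curve_comp.
  + near=> t; split; split => //=.
    * by near: t; exact: near_norm_lt cxe xlt.
    * by near: t; exact: czK.
    * by near: t; exact: near_norm_lt cze zlt.
  + rewrite id_lfunE opprK.
    have e1 : `|r + (es + (ec + eu))| <= 3 * (eps * (C1 * `|r|)).
      have -> : r + (es + (ec + eu)) =
          (es - ps (- r)) + (ec - pc (- r)) + (eu - pu (- r)).
        rewrite -{1}[r]opprK -{1}(sum (- r)).
        by apply/rowP => i; rewrite !mxE; ring.
      rewrite (le_trans (ler_normD _ _))//.
      have := ler_normD (es - ps (- r)) (ec - pc (- r)).
      by move: es_near ec_near eu_near; drop_ineqs; lra.
    have e2 : `|'d (fs j) x es| <= C0 * (2 * (C1 * `|r|)).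
      by rewrite (le_trans (fs_bound _ _ _ esx))// ler_wpM2l// ltW.
    have e3 : `|- (ec + eu)| <= 4 * (C1 * `|r|).
      by rewrite normrN (le_trans (ler_normD _ _))//; move: ec2 eu2; drop_ineqs; lra.
    have e4 : `|Q es| <= CQ * (eps * (C1 * `|r|)).
      have -> : Q es = Q (es - ps (- r)).
        have [Q0 _ _] := ids _ ms.
        by rewrite [RHS]linearB/= [Q (ps _)]lfunE/= !lfunE/= Q0 subrr oppr0 addr0.
      by rewrite (le_trans (HQ _))// ler_wpM2l// ltW.
    have e5 : a * (`|'d (fs j) x es| + `|es| + `|- (ec + eu)|) <= `|r| / 4.
      rewrite -aE ler_wpM2l ?(ltW a0)//.
      by move: e2 e3 es2 C0_gt0; drop_ineqs; lra.
    have := epsE `|r|; move: e1 e4 e5 r_gt0; drop_ineqs; lra.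
(* Now [x = z], and the comparison with [(y, z)] bounds [2 * |Q (z - y)|] by [|z - y|]: the weight 2
   was chosen to produce the cone constant 1/2. *)
- move: xz; rewrite !id_lfunE subr_eq0 => /eqP ->{Xx} h1' h2'.
  have {}h2' : a * (`|fs j z - fs j y| + `|z - y|) + 2 * `|Q (z - y)| <= `|z - y|.
    by rewrite [leRHS]distrC; exact: h2'.
  have {}h1' : a * (`|fs j z - fs j y| + `|z - y| + `|z - p0|) <= `|y - p0|.
    by move: h1'; apply: le_trans; rewrite lerDl mulr_ge0.
  have [n1 n2 n3] := And3 (normr_ge0 (fs j z - fs j y)) (normr_ge0 (z - y))
    (normr_ge0 (z - p0)).
  exists z; split => //.
  + by rewrite ler_pdivlMl// (le_trans _ h1')// ler_wpM2l ?(ltW a0)//; move: n1 n2 n3; drop_ineqs; lra.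
  + by rewrite ler_pdivlMl// (le_trans _ h1')// ler_wpM2l ?(ltW a0)//; move: n1 n2 n3; drop_ineqs; lra.
  + have : 0 <= a * (`|fs j z - fs j y| + `|z - y|).
      by rewrite mulr_ge0 ?(ltW a0)//; move: n1 n2; drop_ineqs; lra.
    by move: h2'; drop_ineqs; lra.
Unshelve. all: by end_near. Qed.

(* A point of [K] near [p] is reached from the leaf of [p] inside [K] along
   [Eu], so that the backward orbits of the two points stay close. *)
Lemma unstable_projection p0 : K p0 -> exists2 r0, 0 < r0 & forall p q,
  K p -> K q -> `|p - p0| < r0 -> `|q - p0| < r0 -> leaf p `<=` K ->
  qS (psi q - psi p) = 0.
Proof.
move=> Kp0; have [C0 C0_gt0 gs_bound] := gs_bounded.
have [ps [pc [pu Pr]]] := projections_exist (E_full p0) (E_direct p0).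
have [C1 C1ge HC1] := lfun_bound3 ps pc pu; have C1gt : 0 < C1 by lra.
set Q := (\1 - ps)%VF; have [CQ CQ0 HQ] := lfun_bound Q.
(* [2 * CQ] accounts for the errors of [eu] and [ec] after [Q]. In [a] below, [2 * C0] accounts for
   the image of [eu], and 4 for [eu] and [ec] themselves. *)
pose eps := (4 * C1 * (1 + 2 * CQ))^-1.
have den0 : 0 < 4 * C1 * (1 + 2 * CQ) by rewrite !mulr_gt0//; lra.
have eps0 : 0 < eps by rewrite invr_gt0.
have eps1 : eps <= 1.
  rewrite invf_le1//; suff: 1 <= C1 * (1 + 2 * CQ) by lra.
  by rewrite mulr_ege1//; lra.
pose a := (4 * C1 * (2 * C0 + 4))^-1.
have dena0 : 0 < 4 * C1 * (2 * C0 + 4) by rewrite !mulr_gt0//; move: C0_gt0; lra.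
have a0 : 0 < a by rewrite invr_gt0.
have aE t : a * ((2 * C0 + 4) * (C1 * t)) = t / 4.
  by rewrite /a; field; rewrite !gt_eqF//; move: C0_gt0; lra.
have epsE t : (1 + 2 * CQ) * (eps * (C1 * t)) = t / 4.
  by rewrite /eps; field; rewrite !gt_eqF//; lra.
have [rho1 rho10 near1] := bundles_near p0 eps0.
have [rho2 rho20 near2] := K_transverse Kp0.
pose rho := Num.min rho1 rho2.
have rho0 : 0 < rho by rewrite lt_min rho10.
have le1 (v : E) : `|v| <= rho -> `|v| <= rho1 by rewrite le_min => /andP[].
have le2 (v : E) : `|v| <= rho -> `|v| <= rho2 by rewrite le_min => /andP[].
have ai0 : 0 < a^-1 by rewrite invr_gt0.
(* The radius serves two ends: [rho] keeps both points where bundles and transversality are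
   controlled, and 1 bounds the displacement of [gs j], as [gs_psi] demands. *)
pose D := 2 + 2 * CQ * a^-1; have CQai : 0 < CQ * a^-1 by rewrite mulr_gt0.
pose r0 := Num.min 1 rho / D.
have D0 : 0 < D by rewrite /D -mulrA; lra.
have mr0 : 0 < Num.min 1 rho by rewrite lt_min ltr01.
have r00 : 0 < r0 by rewrite divr_gt0.
have r0D : r0 * D = Num.min 1 rho by rewrite divfK// gt_eqF.
have r0D1 : r0 * D <= 1 by rewrite r0D ge_min lexx.
have r0D2 : r0 * D <= rho by rewrite r0D ge_min lexx orbT.
have rai : 0 < r0 * (CQ * a^-1) by rewrite mulr_gt0.
have r0DE : r0 * D = 2 * r0 + 2 * (r0 * (CQ * a^-1)) by rewrite /D; ring.
exists r0 => // p q Kp Kq pp0 qp0 pK.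
have leaf_closed : closed (leaf p).
  rewrite (_ : leaf p = [set z | qS (psi z - psi p) = 0]
      `&` [set z | qU (psi z - psi p) = 0]); last first.
    apply/seteqP; split=> z /=; rewrite /leaf /= LcP.
      by move=> /andP[/eqP-> /eqP->].
    by move=> [-> ->]; rewrite eqxx.
  by apply: closedI; apply: closed_lfun_eq0.
suff H e : 0 < e -> `|qS (psi q - psi p)| <= e.
  by apply/eqP; rewrite -normr_le0; apply/ler_addgt0Pr => e /H; rewrite add0r.
move=> e0; have [j gsj] := gs_psi e0.
have Mqp : `|Q (q - p)| <= CQ * (2 * r0).
  rewrite (le_trans (HQ _))// ler_wpM2l ?(ltW CQ0)//.
  have := ler_distD p0 q p; rewrite (distrC p0 p); move: pp0 qp0; drop_ineqs; lra.
have bnd (w : E) : a * `|w| <= `|Q (q - p)| -> `|w| <= a^-1 * (CQ * (2 * r0)).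
  by rewrite -ler_pdivlMl// => /le_trans; apply; rewrite ler_wpM2l// ltW.
have bndE : a^-1 * (CQ * (2 * r0)) = 2 * (r0 * (CQ * a^-1)) by ring.
rewrite bndE in bnd.
have near_p0 (w v : E) : a * `|w - v| <= `|Q (q - p)| -> `|v - p0| < r0 ->
    `|w - p0| < rho.
  by move=> /bnd wv vp0; have := ler_distD v w p0; move: wv vp0 r0DE r0D2 r00; drop_ineqs; lra.
(* The first point moves in [K] along [Eu], the second in the leaf along [Ec]. Neither has a stable
   direction at its disposal, so only the component [Q (x - z)] can be driven to 0. *)
have [||||||||x [z [[Kx xrho] [lz zrho] /eqP xz h1 _]]] := @descent R m
    (K `&` [set x | `|x - p0| <= rho]) (leaf p `&` [set x | `|x - p0| <= rho])
    (gs j) Q 0 a 0 q p.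
- exact: compact_closed_ball.
- exact: compact_closed_ball.
- by split => //=; move: qp0 r0DE r0D2 r00 rai; drop_ineqs; lra.
- by split; [rewrite /leaf/= subrr mem0v|rewrite /=; move: pp0 r0DE r0D2 r00 rai; drop_ineqs; lra].
- by move=> x; exact: differentiable_continuous.
- by [].
- by [].
- move=> x z [Kx /= xrho] [lz /= zrho] rneq0 ax az.
  have xlt : `|x - p0| < rho by exact: near_p0 ax qp0.
  have zlt : `|z - p0| < rho by exact: near_p0 az pp0.
  set r := Q (x - z) in rneq0 *; have r_gt0 : 0 < `|r| by rewrite normr_gt0.
  case: Pr => mem sum ids idc idu.
  have [ms mc mu] := mem (- r).
  have [bs bc bu] := HC1 (- r); rewrite normrN in bs bc bu.
  have [_ _ /(_ _ mu)[eu eux eu_near]] := near1 x (le1 (x - p0) xrho).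
  have [_ /(_ _ mc)[ec ecz ec_near] _] := near1 z (le1 (z - p0) zrho).
  have [ec2 {}ec_near] := approx_norm eps0 eps1 ec_near bc.
  have [eu2 {}eu_near] := approx_norm eps0 eps1 eu_near bu.
  have eu' : eu \in (Ec x + Eu x)%VS by rewrite (subvP (addvSr _ _)).
  have [cx cxe cxK] := K_tangent Kx eu'.
  have ec' : - ec \in Ec z by rewrite memvN.
  have [cz cze czl] := leaf_tangent ec'.
  have QE v : Q v = v - ps v by rewrite !lfunE/= !lfunE.
  exists cx, cz, eu, (- ec), ('d (gs j) x eu).
  split => //.
  + exact: tangent_curve_comp.
  + near=> t; split; split => /=.
    * by near: t; exact: cxK.
    * by near: t; exact: near_norm_lt cxe xlt.
    * have : leaf z (cz t) by near: t; exact: czl.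
      move: lz; rewrite /leaf/= => lz lzt.
      by rewrite -(subrK (psi z) (psi (cz t))) -addrA memvD.
    * by near: t; exact: near_norm_lt cze zlt.
  + rewrite opprK mul0r addr0.
    have psr : ps (- r) = 0.
      rewrite linearN/= /r QE linearB/=.
      have [m1 _ _] := mem (x - z); have [-> _ _] := ids _ m1.
      by rewrite subrr oppr0.
    have e1 : `|r + Q (eu + ec)| <= CQ * (2 * (eps * (C1 * `|r|))).
      have -> : r + Q (eu + ec) = Q ((eu - pu (- r)) + (ec - pc (- r))).
        have -> : (eu - pu (- r)) + (ec - pc (- r)) = (eu + ec) + r.
          rewrite -[in RHS](opprK r) -[in RHS](sum (- r)) psr add0r.
          by apply/rowP => i; rewrite !mxE; ring.
        rewrite [RHS]linearD/= [RHS]addrC; congr (_ + _).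
        move/eqP: psr; rewrite linearN oppr_eq0 => /eqP psr.
        by rewrite [RHS]QE psr subr0.
      rewrite (le_trans (HQ _))// ler_wpM2l ?(ltW CQ0)//.
      by rewrite (le_trans (ler_normD _ _))//; move: eu_near ec_near; drop_ineqs; lra.
    have e2 : `|'d (gs j) x eu| <= C0 * (2 * (C1 * `|r|)).
      by rewrite (le_trans (gs_bound _ _ _ eux))// ler_wpM2l// ltW.
    have e5 : a * (`|'d (gs j) x eu| + `|eu| + `|- ec|) <= `|r| / 4.
      rewrite -aE ler_wpM2l ?(ltW a0)//= normrN.
      by move: e2 ec2 eu2 C0_gt0; drop_ineqs; lra.
    have e7 : 0 <= eps * (C1 * `|r|) by rewrite mulr_ge0 ?(ltW eps0)// mulr_ge0 ?ltW.
    have := epsE `|r|; move: e1 e5 e7 r_gt0; drop_ineqs; lra.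
(* The inclusion of the leaf in [K] is used here: both points lie in [K] and differ by a vector of
   [Es p0], so transversality identifies them. *)
- have Kz : K z by exact: pK.
  have xzE : x = z.
    apply: near2 => //; [exact: le2|exact: le2|].
    have [mem _ _ _ _] := Pr; have [ms _ _] := mem (x - z).
    suff -> : x - z = ps (x - z) by [].
    by apply/eqP; rewrite -subr_eq0; move: xz; rewrite !lfunE/= !lfunE.
  rewrite xzE in h1 *; rewrite {xz xzE x Kx xrho}.
  move: h1; rewrite mul0r addr0 => h1.
  have [n2 n3] := conj (normr_ge0 (z - q)) (normr_ge0 (z - p)).
  have /bnd zq : a * `|gs j q - gs j z| <= `|Q (q - p)|.
    apply: le_trans h1; rewrite ler_wpM2l ?(ltW a0)// distrC; move: n2 n3; drop_ineqs; lra.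
  have -> : qS (psi q - psi p) = qS (psi q - psi z).
    have : qS (psi z - psi p) = 0.
      by move: lz; rewrite /leaf/= LcP => /andP[/eqP].
    by rewrite !linearB/= => /eqP; rewrite subr_eq0 => /eqP->.
  by apply: gsj; move: zq r0DE r0D1 r00; drop_ineqs; lra.
Unshelve. all: by end_near. Qed.

Lemma local_saturation p0 : K p0 -> exists2 r, 0 < r & forall p y,
  K p -> `|p - p0| < r -> leaf p `<=` K -> `|y - p| < r ->
  qS (psi y - psi p) = 0 -> K y.
Proof.
move=> Kp0.
have [ps [pc [pu Pr]]] := projections_exist (E_full p0) (E_direct p0).
have [r1 [C [r10 C0 stable]]] :
  exists r0 C, [/\ 0 < r0, 0 < C & forall y, `|y - p0| < r0 -> forall j,
    exists x, [/\ K x, `|x - y| <= C * `|y - p0|,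
      `|fs j x - fs j y| <= C * `|y - p0| &
      `|(\1 - ps)%VF (x - y)| <= 2^-1 * `|x - y|]].
  by apply: stable_projection => //; exists pc, pu.
have [r2 r20 unstable] := unstable_projection Kp0.
have [r3 r30 transverse] := leaf_transverse Ec_lsc Es_dim Ec_dim psiK psi'K psi_cont psi'_cont
  Lc_dim leaf_tangent Pr.
set Q := (\1 - ps)%VF in stable transverse.
pose m0 := Num.min (Num.min r1 r2) (Num.min r3 1).
have m00 : 0 < m0 by rewrite !lt_min r10 r20 r30 ltr01.
have m01 : m0 <= r1 by rewrite !ge_min lexx.
have m02 : m0 <= r2 by rewrite !ge_min lexx !orbT.
have m03 : m0 <= r3 by rewrite !ge_min lexx !orbT.
have m04 : m0 <= 1 by rewrite !ge_min lexx !orbT.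
(* [y] is within [2 * r] of [p0] and the candidates [x] are within [2 * r * C] of [y]. Hence all are
   within [m0] of [p0], and as [m0 <= 1], the iterates of [x] and [y] are within 1. *)
pose r := m0 / (2 + 2 * C).
have rE : r * (2 + 2 * C) = m0 by rewrite divfK// gt_eqF//; move: C0; drop_ineqs; lra.
have r0 : 0 < r by rewrite divr_gt0//; move: C0; drop_ineqs; lra.
have rC : 0 < r * C by rewrite mulr_gt0.
exists r => // p y Kp pp0 pK yp py.
have yp0 : `|y - p0| < 2 * r.
  by have := ler_distD p y p0; move: yp pp0; drop_ineqs; lra.
have dyE : C * `|y - p0| <= 2 * (r * C).
  by have := ler_wpM2l (ltW C0) (ltW yp0); drop_ineqs; lra.
have near_p0 (x : E) : `|x - y| <= C * `|y - p0| -> `|x - p0| < m0.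
  by have := ler_distD y x p0; move: yp0 dyE rE r0; drop_ineqs; lra.
have yr1 : `|y - p0| < m0 by move: yp0 rE rC; drop_ineqs; lra.
pose G := [set x | `|Q (x - y)| <= 2^-1 * `|x - y|].
have G_closed : closed G.
  apply: (@closed_le_fun _ E (fun x => `|Q (x - y)|)).
    have -> : (fun x => `|Q (x - y)|) = (fun x => `|Q x - Q y|).
      by apply/funext => z; rewrite linearB.
    apply: (@continuous_norm_sub _ E E Q) => z; exact: lfun_continuous.
  have c2 : continuous (fun x : E => `|x - y|).
    by apply: (@continuous_norm_sub _ E E id) => z; exact: cvg_id.
  exact: continuous_scale.
(* [A] does not depend on [j] but contains a candidate for each [j], so the least unstable
   discrepancy over [A] is below every positive number. Its minimiser is the single point [y']. *)
pose A := (K `&` G) `&` [set x | `|x - y| <= C * `|y - p0|].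
have A_compact : compact A by apply: compact_closed_ball; exact: closedI.
have A_exists j : exists2 x, A x & `|fs j x - fs j y| <= 1.
  have [x [Kx xy fxy Qx]] := stable y (lt_le_trans yr1 m01) j.
  exists x; first by [].
  by rewrite (le_trans fxy)//; move: dyE rE m04 r0; drop_ineqs; lra.
have [||y' y'A y'min] := @compact_EVT_min _ _ (fun x => `|qU (psi x - psi y)|) A _ A_compact.
- by have [x Ax _] := A_exists 0; exists x.
- apply: continuous_subspaceT.
  have -> : (fun x => `|qU (psi x - psi y)|) = (fun x => `|qU (psi x) - qU (psi y)|).
    by apply/funext => z; rewrite linearB.
  apply: (@continuous_norm_sub _ E E (qU \o psi)) => x.
  by apply: continuous_comp; [exact: psi_cont|exact: lfun_continuous].
have {y'A}[[Ky' Gy'] yy'] : A y' by rewrite inE in y'A.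
have qU0 : qU (psi y' - psi y) = 0.
  apply/eqP; rewrite -normr_le0; apply/ler_addgt0Pr => e e0; rewrite add0r.
  have [j hj] := fs_psi e0; have [x Ax fx] := A_exists j.
  by rewrite (le_trans (y'min x _)) ?inE// hj.
have qS0 : qS (psi y' - psi y) = 0.
  have : qS (psi y' - psi p) = 0.
    apply: unstable => //; last exact: lt_le_trans (near_p0 _ yy') m02.
    by apply: lt_le_trans m02; move: pp0 rE r0 rC; drop_ineqs; lra.
  rewrite !linearB/= in py * => /eqP; rewrite subr_eq0 => /eqP ->.
  by move/eqP: py; rewrite subr_eq0 => /eqP ->; rewrite subrr.
suff -> : y = y' by [].
apply/esym/transverse.
- exact: lt_le_trans yr1 m03.
- exact: lt_le_trans (near_p0 _ yy') m03.
- by rewrite /leaf/= LcP qS0 qU0 eqxx.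
- exact: Gy'.
Qed.

Hypothesis psi_lattice : forall k, int_vector k ->
  exists2 l, int_vector l & forall x, psi (x + k) = psi x + l.
Hypothesis psi'_lattice : forall k, int_vector k ->
  exists2 l, int_vector l & forall x, psi' (x + k) = psi' x + l.
Hypothesis K_lattice : forall k l, K k -> int_vector l -> K (k + l).

(** The part of [K] in the unit cube is compact, which makes the radius of [local_saturation] common
    to it. Lattice translations preserve [K] and permute the lifted leaves, so they carry this
    radius everywhere. *)
Lemma uniform_saturation : exists2 r, 0 < r & forall p y,
  leaf p `<=` K -> `|y - p| < r -> qS (psi y - psi p) = 0 -> K y.
Proof.
pose P (r : R) (p : E) := forall y, K p -> leaf p `<=` K -> `|y - p| < r ->
  qS (psi y - psi p) = 0 -> K y.
have cube : compact (K `&` [set x | `|x - 0| <= 1]) by exact: compact_closed_ball.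
have /compact_near_coveringP/(_ R (0 : R)^'+ P _) := cube.
move=> H; have [r [r0 rP]] : exists r, 0 < r /\
    K `&` [set x | `|x - 0| <= 1] `<=` P r.
  near (0 : R)^'+ => r; exists r; split => //; near: r; apply: H => x [Kx _].
  have [r r0 H] := local_saturation Kx.
  exists ([set x' | `|x' - x| < r], [set s | s < r]) => /=.
    by split; [exact: near_dist|exact: nbhs_right_lt].
  move=> [x' s] [/= x'x sr] y Kx' lK yx'; apply: (H x') => //.
  exact: lt_trans sr.
exists r => // p y pK yp py.
have leafp : leaf p p by rewrite /leaf/= subrr mem0v.
have [k k_int pk] := int_vector_cube p.
have [l l_int psik] := psi_lattice k_int.
have leafk : leaf (p + k) `<=` K.
  move=> z; rewrite /leaf/= -{1}(subrK k z) !psik.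
  rewrite opprD addrACA subrr addr0 => zp.
  by rewrite -(subrK k z); apply: K_lattice => //; exact: pK.
have : K (y + k).
  apply: (rP (p + k)) => //.
  - by split; [apply: K_lattice => //; exact: pK|rewrite /= subr0].
  - by apply: K_lattice => //; exact: pK.
  - by rewrite opprD addrACA subrr addr0.
  - by rewrite !psik opprD addrACA subrr addr0.
have kN : int_vector (- k) by move=> i; rewrite mxE rpredN.
by move=> /K_lattice/(_ kN); rewrite addrK.
Unshelve. all: by end_near. Qed.

Hypothesis psi'_unif : forall eps, 0 < eps -> exists2 d, 0 < d &
  forall x y, `|x - y| < d -> `|psi' x - psi' y| < eps.

(** Uniform continuity of [psi'] turns the radius into a step length on the linear side. Each point
    of the new leaf is compared with the point of the old one whose image differs by [w]; since a
    whole leaf is again inside [K], the step can be repeated. *)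
Lemma saturation_step : exists2 d, 0 < d & forall p w,
  leaf p `<=` K -> qS w = 0 -> `|w| < d -> leaf (psi' (psi p + w)) `<=` K.
Proof.
have [r r0 H] := uniform_saturation; have [d d0 Hd] := psi'_unif r0.
exists d => // p w pK qw wd z; rewrite /leaf/= psi'K => lz.
have lz' : psi z - w - psi p \in Lc by rewrite addrAC -addrA -opprD.
apply: (H (psi' (psi z - w))).
- move=> z'; rewrite /leaf/= psi'K => lz''; apply: pK.
  rewrite /leaf/= -(subrK (psi z - w) (psi z')) -addrA.
  exact: memvD.
- rewrite -{1}[z]psiK; apply: Hd.
  by rewrite opprB addrCA subrr addr0.
- by rewrite psi'K opprB addrCA subrr addr0.
Qed.

Lemma saturation p w : leaf p `<=` K -> qS w = 0 -> K (psi' (psi p + w)).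
Proof.
move=> pK qw; have [d d0 H] := saturation_step.
have [N N0 wN] : exists2 N, (0 < N)%N & `|w| / N%:R < d.
  exists (Num.bound (`|w| / d)).+1 => //.
  rewrite ltr_pdivrMr ?ltr0n// mulrC -ltr_pdivrMr//.
  rewrite (lt_trans (archi_boundP _)) ?divr_ge0 ?(ltW d0)//.
  by rewrite ltr_nat.
have Nn0 : N%:R != 0 :> R by rewrite pnatr_eq0 -lt0n.
pose v := N%:R^-1 *: w.
have vd : `|v| < d by rewrite normrZ ger0_norm ?invr_ge0 ?ler0n// mulrC.
have qv : qS v = 0 by rewrite linearZ/= qw scaler0.
have step j : leaf (psi' (psi p + j%:R *: v)) `<=` K.
  elim: j => [|j IH]; first by rewrite scale0r addr0 psiK.
  have := H _ _ IH qv vd; rewrite psi'K -addrA -[X in _ + X]addrC.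
  by rewrite -natr1 scalerDl scale1r [v + _]addrC.
have := step N; rewrite /v scalerA divff// scale1r; apply.
by rewrite /leaf/= subrr mem0v.
Qed.

Hypothesis qSK : forall v, qS (qS v) = qS v.
Hypothesis qS_lattice_dense : forall v eps, 0 < eps ->
  exists2 k, int_vector k & `|qS v - qS k| <= eps.

Lemma leaf_not_subset p : ~ leaf p `<=` K.
Proof.
move=> pK; have Kp : K p by apply: pK; rewrite /leaf/= subrr mem0v.
have all_K x : K x.
  rewrite -[x]psiK; apply: K_closed => U /= Ux.
  have [e e0 He] : exists2 e, 0 < e & forall y, `|y - psi x| <= e -> U (psi' y).
    by apply: near_radius; exact: psi'_cont Ux.
  have [k k_int ke] := qS_lattice_dense (psi x - psi p) e0.
  have [l l_int psi'k] := psi'_lattice k_int.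
  (* [v] leads from [psi p + k] to [psi x]. Discarding its stable part keeps the end point in the
     saturated set and misses [psi x] by [qS v] only, which is small by the choice of [k]. *)
  pose v := psi x - psi p - k; pose w := v - qS v.
  have qw : qS w = 0 by rewrite linearB/= qSK subrr.
  exists (psi' (psi p + w + k)); split.
    by rewrite psi'k; apply: K_lattice => //; exact: saturation.
  apply: He; have -> : psi p + w + k - psi x = - qS v.
    by rewrite /w /v; apply/rowP => i; rewrite !mxE; ring.
  by rewrite normrN linearB.
have [rho rho0 H] := K_transverse Kp.
have e0 : vpick (Es p) != 0 by rewrite vpick0 -dimv_eq0 Es_dim.
pose e := (rho / `|vpick (Es p)|) *: vpick (Es p).
have en : `|e| = rho.
  by rewrite normrZ ger0_norm ?divr_ge0 ?(ltW rho0)// divfK ?normr_eq0.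
have : p + e = p.
  apply: H => //.
  - by rewrite addrAC subrr add0r en.
  - by rewrite subrr normr0 ltW.
  - by rewrite addrAC subrr add0r memvZ// memv_pick.
move/eqP; rewrite -subr_eq0 addrAC subrr add0r -normr_eq0 en.
by rewrite gt_eqF.
Qed.

End Local.

(** * Topology of the torus *)

Section TorusTopology.
Variables (R : realType) (m : nat).
Local Notation E := 'rV[R]_m.
Local Notation T := (torus R m).

Lemma tprojP (x y : E) : tproj x = tproj y <-> int_vector (x - y).
Proof.
have tprojE z : tproj z = (\pi_{eq_quot (@lattice_equiv R m)} z)%qT by [].
rewrite !tprojE; split=> [/eqmodP/forallP xy i|xy].
  by have := xy i; rewrite !mxE.
by apply/eqmodP/forallP => i; have := xy i; rewrite !mxE.
Qed.

Lemma tproj_repr (p : T) : tproj (repr p) = p.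
Proof. exact: reprK. Qed.

Lemma tproj_surj (p : T) : exists x, tproj x = p.
Proof. by exists (repr p); exact: tproj_repr. Qed.

Lemma int_vectorN (k : E) : int_vector k -> int_vector (- k).
Proof. by move=> h i; rewrite mxE rpredN. Qed.

Lemma int_vectorD (k l : E) : int_vector k -> int_vector l -> int_vector (k + l).
Proof. by move=> h h' i; rewrite mxE rpredD. Qed.

Lemma tprojD (x k : E) : int_vector k -> tproj (x + k) = tproj x.
Proof. by move=> h; apply/tprojP; rewrite addrAC subrr add0r. Qed.

Lemma int_vector_small (k : E) : int_vector k -> `|k| < 1 -> k = 0.
Proof.
move=> kZ k1; apply/rowP => i; rewrite mxE.
have ki : `|k ord0 i| < 1 by exact: le_lt_trans (le_coord _ _) k1.
have /intrP[z kz] := kZ i; move: ki; rewrite kz -intr_norm.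
by rewrite -[1 in X in X -> _]/(1%:~R) ltr_int; case: z {kz} => [[]|].
Qed.

Lemma tproj_continuous : continuous (@tproj R m).
Proof. exact: pi_continuous. Qed.

Lemma near_translate (x k : E) (P : set E) :
  (\forall y \near x, P y) -> \forall y \near x + k, P (y - k).
Proof.
move=> /near_radius[r r0 H]; near=> y; apply: H.
rewrite -addrA -opprD [k + x]addrC ltW//; near: y; exact: near_dist.
Unshelve. all: by end_near. Qed.

Lemma tproj_open (O : set E) : open O -> open (@tproj R m @` O).
Proof.
move=> oO; suff : open (@tproj R m @^-1` (@tproj R m @` O)) by [].
rewrite openE => x [y Oy] /tprojP yx.
have -> : x = y + (x - y) by rewrite addrC subrK.
have := near_translate (x - y) (open_nbhs_nbhs (conj oO Oy)).
apply: filterS => z Oz /=; exists (z - (x - y)) => //.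
by apply/tprojP; rewrite addrAC subrr add0r opprB.
Qed.

Lemma near_tproj (x : E) (P : set T) :
  (\forall y \near x, P (tproj y)) <-> \forall q \near tproj x, P q.
Proof.
split; last by move/(@tproj_continuous x).
rewrite -[X in X -> _]/(nbhs x (fun y => P (tproj y))) nbhsE.
move=> -[U [oU Ux] UP].
have : nbhs (tproj x) (@tproj R m @` U).
  by apply: open_nbhs_nbhs; split; [exact: tproj_open|exists x].
by apply: filterS => _ [y Uy <-]; exact: UP.
Qed.

(** Lifts of distinct points differ in some coordinate by a non-integer [a]. If [a] has distance at
    least [2 * r] from every integer, no point of the [r]-ball about one lift is a lattice translate
    of a point of the [r]-ball about the other. *)
Lemma torus_hausdorff : hausdorff_space T.
Proof.
rewrite open_hausdorff => p q pq.
have [i xyi] : exists i, (repr p - repr q) ord0 i \isn't a Num.int.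
  apply: contrapT => h; move/eqP: pq; apply.
  rewrite -[p]tproj_repr -[q]tproj_repr; apply/tprojP => i.
  by apply/negPn/negP => hi; apply: h; exists i.
set a := (repr p - repr q) ord0 i in xyi.
have [r r0 rP] : exists2 r, 0 < r & forall z : int, 2 * r <= `|a - z%:~R|.
  pose z0 := Num.floor a; have /andP[h1 h2] := floor_itv a.
  have h1' : z0%:~R < a.
    by rewrite lt_neqAle h1 andbT; apply: contraNneq xyi => <-; exact: intr_int.
  pose r := Num.min (a - z0%:~R) ((z0 + 1)%:~R - a).
  have r0 : 0 < r by rewrite lt_min !subr_gt0 h1'.
  exists (r / 2); first by rewrite divr_gt0.
  move=> z; rewrite mulrC divfK//; have [zz|zz] := leP z z0.
    have : z%:~R <= z0%:~R :> R by rewrite ler_int.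
    move=> zz'; rewrite ger0_norm ?subr_ge0 ?(le_trans zz')//.
    by rewrite /r ge_min lerD2l lerN2 zz'.
  have zz' : (z0 + 1)%:~R <= z%:~R :> R by rewrite ler_int lezD1.
  rewrite distrC ger0_norm ?subr_ge0 ?(le_trans (ltW h2))//.
  by rewrite /r ge_min lerD2r zz' orbT.
exists (@tproj R m @` [set x | `|x - repr p| < r],
        @tproj R m @` [set x | `|x - repr q| < r]).
  split; rewrite inE /=.
    by exists (repr p); [rewrite subrr normr0|exact: tproj_repr].
  by exists (repr q); [rewrite subrr normr0|exact: tproj_repr].
have ball_open (x : E) : open [set y | `|y - x| < r].
  rewrite (_ : [set _ | _] = ball x r); first exact: ball_open.
  by apply/seteqP; split=> y; rewrite -ball_normE/= distrC.
split; try exact: tproj_open.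
apply/eqP; rewrite -subset0 => _ [[x /= xp <-] [y /= yq /esym/tprojP xy]].
have /intrP[z xyz] := xy i.
have := rP z; rewrite -xyz /a leNgt => /negP; apply.
have -> : (repr p - repr q) ord0 i - (x - y) ord0 i =
    (y - repr q) ord0 i - (x - repr p) ord0 i by rewrite !mxE; ring.
rewrite (le_lt_trans (ler_normB _ _))//.
have := le_coord (y - repr q) i; have := le_coord (x - repr p) i.
by move: xp yq; drop_ineqs; lra.
Qed.

End TorusTopology.

(** * Lifting maps of the torus to the universal cover *)

Section Lifting.
Variable R : realType.

(** If a coordinate took different values at the ends, its range would contain an interval of
    positive Lebesgue measure, whereas countable sets are null. The set [C] may be dense, as
    projections of the lattice are in the applications. *)
Lemma countable_path_const (m : nat) (u : R -> 'rV[R]_m) (C : set 'rV[R]_m) :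
  countable C -> (forall t, 0 <= t <= 1 -> {for t, continuous u}) ->
  (forall t, 0 <= t <= 1 -> C (u t)) -> u 0 = u 1.
Proof.
move=> cC cu uC; apply/rowP => i.
pose v t := u t ord0 i.
have cv : {within `[0, 1], continuous v}.
  apply: continuous_in_subspaceT => t; rewrite inE/= in_itv/= => t01.
  apply: (@continuous_comp _ _ _ u (fun x : 'rV[R]_m => x ord0 i)).
    exact: cu.
  exact: coord_continuous.
have cCi : countable [set x ord0 i | x in C] := sub_countable (card_image_le _ _) cC.
apply: contrapT => /eqP v01.
pose a := Num.min (v 0) (v 1); pose b := Num.max (v 0) (v 1).
have ab : a < b by rewrite /a /b; case: (ltgtP (v 0) (v 1)) => // h; case/eqP: v01.
have sub : `[a, b]%classic `<=` [set x ord0 i | x in C].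
  move=> y; rewrite /= in_itv/= => aby.
  have [t t01 <-] := IVT ler01 cv aby.
  by exists (u t) => //; apply: uC; move: t01; rewrite in_itv.
have := countable_lebesgue_measure0 (sub_countable (subset_card_le sub) cCi).
by rewrite lebesgue_measure_itv/= lte_fin ab -EFinD => /eqP; rewrite eqe subr_eq0 gt_eqF.
Qed.

Lemma countable_ball_const (d m : nat) (u : 'rV[R]_d -> 'rV[R]_m)
    (C : set 'rV[R]_m) (x0 : 'rV[R]_d) r : countable C ->
  (forall z, `|z - x0| < r -> {for z, continuous u}) ->
  (forall z, `|z - x0| < r -> C (u z)) ->
  forall x, `|x - x0| < r -> u x = u x0.
Proof.
move=> cC cu uC x xr.
pose l (t : R) := x0 + t *: (x - x0).
have lr t : 0 <= t <= 1 -> `|l t - x0| < r.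
  move=> /andP[t0 t1]; rewrite /l addrAC subrr add0r normrZ ger0_norm//.
  by rewrite (le_lt_trans _ xr)// ler_piMl.
have cl : continuous l.
  by move=> t; apply: cvgD; [exact: cvg_cst|exact: scalel_continuous].
have := @countable_path_const _ (u \o l) C cC.
rewrite /= /l scale0r addr0 scale1r [x0 + _]addrC subrK => H; apply/esym/H.
- move=> t t01; apply: continuous_comp; first exact: cl.
  by apply: cu; exact: lr.
- by move=> t /lr; exact: uC.
Qed.

Lemma countable_const (d m : nat) (u : 'rV[R]_d -> 'rV[R]_m)
    (C : set 'rV[R]_m) : countable C -> continuous u ->
  (forall z, C (u z)) -> forall x y, u x = u y.
Proof.
move=> cC cu uC x y.
apply: (@countable_ball_const _ _ u C y (`|x - y| + 1)) => //.
- by move=> z _; exact: cu.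
- by rewrite ltrDl.
Qed.

Lemma countable_int_vector (m : nat) : countable [set k : 'rV[R]_m | int_vector k].
Proof.
have : countable [set (map_mx intr k : 'rV[R]_m) | k in [set: 'rV[int]_m]].
  exact: sub_countable (card_image_le _ _) (countableP _).
apply: sub_countable; apply: subset_card_le => k kZ.
exists (\row_i Num.floor (k ord0 i)) => //; apply/rowP => i; rewrite !mxE.
by apply: floorK; exact: kZ.
Qed.

End Lifting.

Section Lift.
Variables (R : realType) (m : nat).
Local Notation E := 'rV[R]_m.
Local Notation T := (torus R m).

(** Compactness of the unit cube for properties that are invariant under the lattice: a radius valid
    locally becomes valid on the whole cover. *)
Lemma cube_near (P : R -> E -> Prop) :
  (forall k d x, int_vector k -> P d (x + k) -> P d x) ->
  (forall x0 : E, \forall x \near x0 & d \near (0 : R)^'+, P d x) ->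
  exists2 d, 0 < d & forall x, P d x.
Proof.
move=> Pk Pnear.
have cube : compact (setT `&` [set x : E | `|x - 0| <= 1]).
  by apply: compact_closed_ball; exact: closedT.
have /compact_near_coveringP/(_ R (0 : R)^'+ P _) := cube.
move=> H; have [d [d0 dP]] : exists d, 0 < d /\
    setT `&` [set x : E | `|x - 0| <= 1] `<=` P d.
  by near (0 : R)^'+ => d; exists d; split => //; near: d; apply: H.
exists d => // x; have [k kZ xk] := int_vector_cube x.
by apply: (Pk k) => //; apply: dP; split=> //; rewrite /= subr0.
Unshelve. all: by end_near. Qed.

Lemma lattice_unif (F : E -> E) : continuous F ->
  (forall k, int_vector k -> exists2 l, int_vector l & forall x, F (x + k) = F x + l) ->
  forall eps, 0 < eps -> exists2 d, 0 < d &
    forall x y, `|x - y| < d -> `|F x - F y| < eps.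
Proof.
move=> cF FZ eps eps0.
apply: (@cube_near (fun d x => forall y, `|x - y| < d -> `|F x - F y| < eps)).
  move=> k d x kZ H y xy; have [l _ Fk] := FZ k kZ.
  have := H (y + k); rewrite !Fk !opprD.
  by rewrite ![x + k + _]addrACA ![F x + l + _]addrACA !subrr !addr0; apply.
move=> x0.
have e4 : 0 < eps / 4 by rewrite divr_gt0.
have [r r0 H] := near_radius ((continuous_dist F x0).1 (@cF x0) _ e4).
have r2 : 0 < r / 2 by rewrite divr_gt0.
exists ([set x | `|x - x0| < r / 2], [set s | s < r / 2]) => /=.
  by split; [exact: near_dist|exact: nbhs_right_lt].
move=> [x s] [/= xx0 sr] y xy.
have h1 : `|F x - F x0| <= eps / 4.
  by apply: H; move: xx0 r0; drop_ineqs; lra.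
have h2 : `|F y - F x0| <= eps / 4.
  apply: H; have := ler_distD x y x0; rewrite [`|y - x|]distrC.
  by move: xx0 sr xy; drop_ineqs; lra.
have := ler_distD (F x0) (F x) (F y); rewrite [`|F x0 - _|]distrC.
by move: h1 h2 eps0; drop_ineqs; lra.
Qed.

Lemma lift_unique (F G : E -> E) : continuous F -> continuous G ->
  (forall x, tproj (F x) = tproj (G x)) ->
  exists2 k, int_vector k & forall x, F x = G x + k.
Proof.
move=> cF cG FG.
have FGZ x : int_vector (F x - G x) by exact/tprojP.
exists (F 0 - G 0) => // x.
have cFG : continuous (F \- G).
  by move=> z; apply: (@continuousB _ _ _ F G z); [exact: cF|exact: cG].
have H : F x - G x = F 0 - G 0.
  exact: (countable_const (countable_int_vector R m) cFG FGZ).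
by rewrite -H addrC subrK.
Qed.

Variable f : T -> T.
Hypothesis f_cont : continuous f.

Lemma near_lift (x : E) e : 0 < e -> \forall y \near x,
  exists2 w, `|w| < e & f (tproj y) = tproj (repr (f (tproj x)) + w).
Proof.
move=> e0.
have H : \forall q \near f (tproj x), exists2 w : E, `|w| < e &
    q = tproj (repr (f (tproj x)) + w).
  rewrite -[in X in \forall q \near X, _](tproj_repr (f (tproj x))).
  apply/near_tproj; near=> z; exists (z - repr (f (tproj x))).
    by near: z; exact: near_dist.
  by rewrite addrC subrK.
by apply/(@near_tproj _ _ x (fun p => exists2 w, `|w| < e & f p = tproj _)); exact: f_cont H.
Unshelve. all: by end_near. Qed.

(** The bound 1/4 makes the displacement [w] unique, since two choices differ by an integer vector
    of norm below 1. It results from two displacements below 1/8 relative to a common centre. *)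
Lemma unif_near_lift : exists2 d, 0 < d & forall x y : E, `|x - y| < d ->
  exists2 w, `|w| < 4^-1 & f (tproj y) = tproj (repr (f (tproj x)) + w).
Proof.
apply: (@cube_near (fun d x => forall y, `|x - y| < d ->
  exists2 w, `|w| < 4^-1 & f (tproj y) = tproj (repr (f (tproj x)) + w))).
  move=> k d x kZ H y xy; have := H (y + k); rewrite !tprojD//; apply.
  by rewrite opprD addrACA subrr addr0.
move=> x0; have e8 : 0 < 8^-1 :> R by [].
have [r r0 H] := near_radius (near_lift x0 e8).
have r2 : 0 < r / 2 by rewrite divr_gt0.
exists ([set x | `|x - x0| < r / 2], [set s | s < r / 2]) => /=.
  by split; [exact: near_dist|exact: nbhs_right_lt].
move=> [x s] [/= xx0 sr] y xy.
have [|w1 w1e fx] := H x; first by move: xx0 r0; drop_ineqs; lra.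
have [|w2 w2e fy] := H y.
  have := ler_distD x y x0; rewrite [`|y - x|]distrC.
  by move: xx0 sr xy; drop_ineqs; lra.
exists (w2 - w1).
  by rewrite (le_lt_trans (ler_normB _ _))//; move: w1e w2e; drop_ineqs; lra.
rewrite fy; apply/tprojP; move: fx; rewrite -{1}[f (tproj x)]tproj_repr.
move=> /tprojP/int_vectorN.
by congr int_vector; apply/rowP => i; rewrite !mxE; ring.
Qed.

(** The segment from 0 to [x] is cut into pieces shorter than [d], and the short displacements of
    [f] along them are added up. Different subdivisions give continuous lifts on a ball that agree
    at 0, hence coincide. *)
Lemma lift_exists : exists2 F : E -> E, continuous F &
  forall x, tproj (F x) = f (tproj x).
Proof.
have [d d0 Hd] := unif_near_lift.
pose D x y := [set w : E | `|w| < 4^-1 /\ f (tproj y) = tproj (repr (f (tproj x)) + w)].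
pose disp x y := xget 0 (D x y).
have dispP x y : `|x - y| < d -> D x y (disp x y).
  by move=> xy; apply: (@xgetPex _ 0 (D x y)); have [w] := Hd x y xy; exists w.
have disp0 x : disp x x = 0.
  have [|h1 h2] := dispP x x; first by rewrite subrr normr0.
  apply: int_vector_small; last by move: h1; drop_ineqs; lra.
  move: h2; rewrite -{1}[f (tproj x)]tproj_repr => /esym/tprojP.
  by rewrite addrAC subrr add0r.
have disp_cont x0 y0 e : `|x0 - y0| < d -> 0 < e -> exists2 r, 0 < r &
    forall x y, `|x - x0| <= r -> `|y - y0| <= r -> `|disp x y - disp x0 y0| <= e.
  (* The bound 1/8 makes the integer vector formed by two values of [disp] and the two displacements
     [w1], [w2] shorter than 1, hence 0. *)
  move=> xy0 e0; pose e' := Num.min (e / 2) 8^-1.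
  have e'0 : 0 < e' by rewrite lt_min divr_gt0//=.
  have [r1 r10 H1] := near_radius (near_lift x0 e'0).
  have [r2 r20 H2] := near_radius (near_lift y0 e'0).
  pose r3 := (d - `|x0 - y0|) / 3.
  have r30 : 0 < r3 by rewrite divr_gt0// subr_gt0.
  exists (Num.min r3 (Num.min r1 r2)); first by rewrite !lt_min r10 r20 r30.
  move=> x y; rewrite !le_min => /and3P[x3 x1 _] /and3P[y3 _ y2].
  have [w1 w1e fx] := H1 x x1; have [w2 w2e fy] := H2 y y2.
  have [a1 a2] := dispP _ _ xy0.
  have [|b1 b2] := dispP x y.
    have h1 := ler_distD x0 x y; have h2 := ler_distD y0 x0 y.
    move: h1 h2 x3 y3 r30; rewrite [`|y0 - y|]distrC /r3; drop_ineqs; lra.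
  have e'1 : e' <= e / 2 by rewrite ge_min lexx.
  have e'2 : e' <= 8^-1 by rewrite ge_min lexx orbT.
  have E0 : disp x y - disp x0 y0 + w1 - w2 = 0.
    apply: int_vector_small.
      move: fx; rewrite -{1}[f (tproj x)]tproj_repr => /tprojP c1.
      have c2 := (tprojP _ _).1 (etrans (esym b2) fy).
      move: a2; rewrite -{1}[f (tproj y0)]tproj_repr => /tprojP c4.
      have := int_vectorD (int_vectorD c2 (int_vectorN c1)) c4.
      by congr int_vector; apply/rowP => i; rewrite !mxE; ring.
    have := ler_normB (disp x y - disp x0 y0 + w1) w2.
    have := ler_normD (disp x y - disp x0 y0) w1.
    have := ler_normB (disp x y) (disp x0 y0).
    by move: a1 b1 w1e w2e e'2; drop_ineqs; lra.
  have -> : disp x y - disp x0 y0 = w2 - w1.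
    by apply/eqP; rewrite -subr_eq0 opprB addrA E0.
  rewrite (le_trans (ler_normB _ _))//.
  by move: w1e w2e e'1; drop_ineqs; lra.
pose a0 : E := repr (f (tproj 0)).
pose s (N i : nat) (x : E) : E := (i%:R / N%:R) *: x.
pose pf N j x := a0 + \sum_(i < j) disp (s N i x) (s N i.+1 x).
have pfS N j x : pf N j.+1 x = pf N j x + disp (s N j x) (s N j.+1 x).
  by rewrite /pf big_ord_recr addrA.
have step N i x : (0 < N)%N -> `|x| < N%:R * d -> `|s N i x - s N i.+1 x| < d.
  move=> N0 xN; have N0' : 0 < N%:R :> R by rewrite ltr0n.
  rewrite -scalerBl -mulrBl -natr1 opprD addrA subrr sub0r normrZ normrM normrN1 mul1r.
  by rewrite gtr0_norm ?invr_gt0// mulrC ltr_pdivrMr// mulrC.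
have pf_lift N j x : (0 < N)%N -> `|x| < N%:R * d ->
    tproj (pf N j x) = f (tproj (s N j x)).
  move=> N0 xN; elim: j => [|j IH].
    by rewrite /pf big_ord0 addr0 /s mul0r scale0r tproj_repr.
  have [_ ->] := dispP _ _ (step N j x N0 xN).
  rewrite pfS; apply/tprojP; rewrite opprD addrACA subrr addr0.
  by apply/tprojP; rewrite tproj_repr.
have pf_cont N j x0 : (0 < N)%N -> `|x0| < N%:R * d -> {for x0, continuous (pf N j)}.
  move=> N0 xN; apply/continuous_dist; elim: j => [|j IH] e e0.
    by near=> y; rewrite /pf !big_ord0 subrr normr0 ltW.
  have e2 : 0 < e / 2 by rewrite divr_gt0.
  have [r r0 H] := disp_cont _ _ _ (step N j x0 N0 xN) e2.
  have j0 : 0 < j.+1%:R :> R by rewrite ltr0n.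
  have sB i y : (i <= j.+1)%N -> `|y - x0| < r / j.+1%:R ->
      `|s N i y - s N i x0| <= r.
    move=> ij yx0; rewrite -scalerBr normrZ ger0_norm ?divr_ge0//.
    rewrite -[r](divfK (lt0r_neq0 j0)) [leRHS]mulrC.
    rewrite ler_pM ?divr_ge0 ?(ltW yx0)// ler_pdivrMr ?ltr0n//.
    by rewrite -natrM ler_nat (leq_trans ij)// leq_pmulr.
  have near1 := near_dist x0 (divr_gt0 r0 j0).
  apply: filterS2 near1 (IH _ e2) => y yr Hy.
  rewrite !pfS opprD addrACA (le_trans (ler_normD _ _))//.
  by rewrite [e]splitr lerD// H// sB.
have pf_0 N j : pf N j 0 = a0.
  rewrite /pf big1 ?addr0// => i _.
  by rewrite /s !scaler0 disp0.
have pf_eq N M x : (0 < N)%N -> (0 < M)%N -> `|x| < N%:R * d ->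
    `|x| < M%:R * d -> pf N N x = pf M M x.
  move=> N0 M0 xN xM.
  have h z : `|z - 0| < Num.min (N%:R * d) (M%:R * d) ->
      `|z| < N%:R * d /\ `|z| < M%:R * d.
    by rewrite subr0 lt_min => /andP[].
  have H : pf N N x - pf M M x = pf N N 0 - pf M M 0.
    apply: (@countable_ball_const _ _ _ (pf N N \- pf M M) _ 0
      (Num.min (N%:R * d) (M%:R * d)) (countable_int_vector R m)).
    - move=> z /h[zN zM]; apply: (@continuousB _ _ _ (pf N N) (pf M M) z).
        exact: pf_cont.
      exact: pf_cont.
    - move=> z /h[zN zM]; apply/tprojP.
      rewrite !pf_lift// /s !divff ?pnatr_eq0 -?lt0n//.
    - by rewrite subr0 lt_min xN.
  by apply/eqP; rewrite -subr_eq0 H !pf_0 subrr.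
pose n (x : E) := (Num.bound (`|x| / d)).+1.
have nP x : `|x| < (n x)%:R * d.
  rewrite -ltr_pdivrMr// (lt_trans (archi_boundP _)) ?divr_ge0 ?(ltW d0)//.
  by rewrite ltr_nat.
exists (fun x => pf (n x) (n x) x) => [x0|x]; last first.
  by rewrite pf_lift// /s divff ?scale1r// pnatr_eq0.
have nx0 := nP x0.
apply/continuous_dist => e e0.
have /continuous_dist/(_ e e0) := pf_cont (n x0) (n x0) x0 (ltn0Sn _) nx0.
have gap : 0 < (n x0)%:R * d - `|x0| by rewrite subr_gt0.
apply: filterS2 (near_dist x0 gap) => y yx0.
(* The number of pieces [n y] jumps with [y], but near [x0] the fixed number [n x0] gives the same
   value. *)
rewrite (pf_eq (n y) (n x0) y)//.
by have := ler_normD (y - x0) x0; rewrite subrK; move: yx0; drop_ineqs; lra.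
Unshelve. all: by end_near. Qed.

End Lift.

Section HomeoLift.
Variables (R : realType) (m : nat).
Local Notation E := 'rV[R]_m.
Local Notation T := (torus R m).

Lemma lift_lattice (f : T -> T) (F : E -> E) : continuous F ->
  (forall x, tproj (F x) = f (tproj x)) ->
  forall k, int_vector k -> exists2 l, int_vector l & forall x, F (x + k) = F x + l.
Proof.
move=> cF Ff k kZ.
have ck := @continuous_translate _ m k.
apply: (@lift_unique _ _ (F \o (fun x => x + k)) F).
- by move=> x; apply: continuous_comp; [exact: ck|exact: cF].
- exact: cF.
- by move=> x; rewrite /= !Ff tprojD.
Qed.

(** The composite of any two lifts is a lattice translation; subtracting it from the lift of [g]
    makes the lifts mutually inverse. *)
Lemma homeo_lift (f g : T -> T) : cancel f g -> cancel g f ->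
  continuous f -> continuous g -> exists F G : E -> E,
  [/\ cancel F G, cancel G F, continuous F, continuous G &
      (forall x, tproj (F x) = f (tproj x)) /\
      (forall x, tproj (G x) = g (tproj x))].
Proof.
move=> fK gK cf cg.
have [F cF Ff] := lift_exists cf; have [G0 cG0 Gg] := lift_exists cg.
have id_cont : continuous (@id E) by move=> x; exact: cvg_id.
have cGF : continuous (G0 \o F).
  by move=> x; apply: continuous_comp; [exact: cF|exact: cG0].
have [k kZ kP] : exists2 k, int_vector k & forall x, (G0 \o F) x = id x + k.
  by apply: lift_unique => // x; rewrite /= Gg Ff fK.
pose G y := G0 y - k.
have cG : continuous G.
  have -> : G = (fun x => x + - k) \o G0 by [].
  move=> x; apply: continuous_comp; first exact: cG0.
  exact: continuous_translate.
have GK x : G (F x) = x by rewrite /G [G0 (F x)]kP addrK.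
have Gg' x : tproj (G x) = g (tproj x).
  by rewrite -Gg; apply: tprojD; exact: int_vectorN.
have cFG : continuous (F \o G).
  by move=> x; apply: continuous_comp; [exact: cG|exact: cF].
have [l lZ lP] : exists2 l, int_vector l & forall x, (F \o G) x = id x + l.
  by apply: lift_unique => // x; rewrite /= Ff Gg' gK.
exists F, G; split => // x.
have l0 : l = 0.
  by have := lP (F 0); rewrite /= GK => /eqP; rewrite -subr_eq0 opprD addrA subrr sub0r oppr_eq0 => /eqP.
by have := lP x; rewrite /= l0 addr0.
Qed.

End HomeoLift.

(** * Bundles and tangent maps *)

Lemma near_forall (T : topologicalType) (x0 : T) (I : finType) (P : I -> T -> Prop) :
  (forall i, \forall x \near x0, P i x) -> \forall x \near x0, forall i, P i x.
Proof. exact: filter_forall. Qed.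

Section Bundles.
Variables (R : realType) (m : nat).
Local Notation E := 'rV[R]_m.
Local Notation T := (torus R m).

Lemma scalar_bound (phi : {scalar E}) : exists2 C, 0 < C & forall v, `|phi v| <= C * `|v|.
Proof.
exists (1 + \sum_j `|phi (delta_mx ord0 j)|); first by rewrite ltr_pwDl// sumr_ge0.
move=> v; rewrite [in leLHS](row_sum_delta v) linear_sum/=.
rewrite (le_trans (ler_norm_sum _ _ _))// mulrDl mul1r mulr_suml.
rewrite ler_wpDl// ler_sum// => j _; rewrite linearZ/= normrM mulrC.
by rewrite ler_wpM2l// le_coord.
Qed.

Lemma subbundle_approx (B : T -> {vspace E}) (x0 : E) e0 eps : subbundle B ->
  e0 \in B (tproj x0) -> 0 < eps -> \forall x \near x0,
    exists2 e, e \in B (tproj x) & `|e - e0| <= eps.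
Proof.
move=> sB e0B eps0; have [X HX] := sB (tproj x0).
have [_ X_cont BE] := nbhs_singleton HX.
move: (e0B); rewrite BE => /memv_sumP[v vX e0E].
have [a aP] : exists a : 'I_(\dim (B (tproj x0))) -> R,
    forall i, v i = a i *: X i (tproj x0).
  have H i : exists k, v i = k *: X i (tproj x0) by apply/vlineP; exact: vX.
  by have [a aP] := choice H; exists a.
pose D := 1 + \sum_i `|a i|; have D0 : 0 < D by rewrite ltr_pwDl// sumr_ge0.
have near_X i : \forall x \near x0, `|X i (tproj x) - X i (tproj x0)| <= eps / D.
  apply: (continuous_dist (X i \o @tproj R m) x0).1; last by rewrite divr_gt0.
  by apply: continuous_comp; [exact: tproj_continuous|exact: X_cont].
have near_frame := (near_tproj x0 _).2 HX.
apply: filterS2 (near_forall near_X) near_frame => x Hx [_ _ BxE].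
exists (\sum_i a i *: X i (tproj x)).
  by rewrite BxE; apply: memv_sumr => i _; apply/vlineP; exists (a i).
rewrite e0E -sumrB (le_trans (ler_norm_sum _ _ _))//.
apply: (@le_trans _ _ (\sum_i `|a i| * (eps / D))).
  apply: ler_sum => i _; rewrite aP -scalerBr normrZ ler_wpM2l//.
rewrite -mulr_suml mulrCA -ler_pdivlMl// mulVf ?gt_eqF// ler_pdivrMr// mul1r.
by rewrite lerDr.
Qed.

(** It is enough to approximate the vectors of one basis of the fibre at [x0]: the coordinates of
    [e0] are bounded by multiples of [|e0|], which makes the neighbourhood independent of [e0]. *)
Lemma subbundle_lsc (B : T -> {vspace E}) (x0 : E) : subbundle B ->
  bundle_lsc (B \o @tproj R m) x0.
Proof.
move=> sB eps eps0 /=.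
set U := B (tproj x0); pose b := vbasis U.
have bU (k : 'I_(\dim U)) : b`_k \in U by rewrite vbasis_mem// mem_nth// size_tuple.
have cb (k : 'I_(\dim U)) : {C : R | 0 < C & forall v, `|coord b k v| <= C * `|v|}.
  by apply: cid2; exact: (scalar_bound (coord b k)).
pose C k := s2val (cb k).
pose D := 1 + \sum_k C k.
have C0 k : 0 < C k by rewrite /C; case: (cb k).
have HC k v : `|coord b k v| <= C k * `|v| by rewrite /C; case: (cb k).
have D0 : 0 < D by rewrite ltr_pwDl// sumr_ge0// => k _; rewrite ltW.
have near_b k := subbundle_approx sB (bU k) (divr_gt0 eps0 D0).
apply: filterS (near_forall near_b) => x Hx e0 e0U.
have [e' /all_and2[e'B e'b]] : exists e' : 'I_(\dim U) -> E,
    forall k, e' k \in B (tproj x) /\ `|e' k - b`_k| <= eps / D.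
  have H (k : 'I_(\dim U)) : exists e, e \in B (tproj x) /\ `|e - b`_k| <= eps / D.
    by have [e ? ?] := Hx k; exists e.
  by have [e' He'] := choice H; exists e'.
exists (\sum_k coord b k e0 *: e' k).
  by apply: memv_suml => k _; rewrite memvZ.
rewrite [in X in `|_ - X|](coord_vbasis e0U) -sumrB.
rewrite (le_trans (ler_norm_sum _ _ _))//.
apply: (@le_trans _ _ (\sum_k C k * `|e0| * (eps / D))).
  by apply: ler_sum => k _; rewrite -scalerBr normrZ ler_pM.
rewrite -mulr_suml -mulr_suml mulrC mulrA ler_wpM2r//.
rewrite -mulrA -[leRHS]mulr1 ler_wpM2l ?(ltW eps0)// ler_pdivrMl// mulr1.
by rewrite lerDr.
Qed.

End Bundles.

Section Tangent.
Variables (R : realType).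

Lemma diff_of_approx (d p : nat) (f : 'rV[R]_d -> 'rV[R]_p)
    (df : {linear 'rV[R]_d -> 'rV[R]_p}) (x : 'rV[R]_d) : continuous df ->
  (forall eps, 0 < eps -> \forall y \near x, `|f y - f x - df (y - x)| <= eps * `|y - x|) ->
  differentiable f x /\ 'd f x = df :> (_ -> _).
Proof.
move=> cdf H.
have Ho eps : 0 < eps -> \forall y \near (0 : 'rV[R]_d),
    `|f (y + x) - (f x + df y)| <= eps * `|y|.
  move=> eps0; have := H _ eps0; rewrite [X in X -> _](near_shift 0 x).
  by apply: filterS => y /=; rewrite subr0 addrK opprD addrA.
have dE : 'd f x = df :> (_ -> _).
  by apply: diff_unique => //; apply/eqaddoP => eps /Ho.
split=> //; apply/diff_locallyP; rewrite dE; split=> //.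
by apply/eqaddoP => eps /Ho.
Qed.

Variable m : nat.
Local Notation E := 'rV[R]_m.
Local Notation T := (torus R m).

Lemma lifts_near (F H : E -> E) (x : E) : {for x, continuous F} ->
  {for x, continuous H} -> (\forall y \near x, tproj (F y) = tproj (H y)) ->
  \forall y \near x, F y - H y = F x - H x.
Proof.
move=> cF cH FH; have FHx := nbhs_singleton FH.
have e4 : 0 < 4^-1 :> R by [].
apply: filterS3 FH ((continuous_dist F x).1 cF _ e4)
  ((continuous_dist H x).1 cH _ e4) => y FHy Fy Hy.
apply/eqP; rewrite -subr_eq0; apply/eqP/int_vector_small.
  by apply: int_vectorD; [exact/tprojP|apply: int_vectorN; exact/tprojP].
have -> : F y - H y - (F x - H x) = (F y - F x) - (H y - H x).
  by apply/rowP => i; rewrite !mxE; ring.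
by rewrite (le_lt_trans (ler_normB _ _))//; move: Fy Hy; drop_ineqs; lra.
Qed.

(** [is_tangent_map] speaks of some local lift at some preimage of [p]. After a lattice translation
    that lift differs from [F] by a local constant, so the derivatives agree. *)
Lemma tangent_map_lift (f : T -> T) (F : E -> E) (p : T) (A : 'M[R]_m) (x : E) :
  continuous F -> (forall y, tproj (F y) = f (tproj y)) ->
  is_tangent_map f p A -> tproj x = p ->
  differentiable F x /\ forall v, 'd F x v = v *m A.
Proof.
move=> cF Ff [x1 [F1 [x1p F1f dF1 JF1]]] xp.
have kZ : int_vector (x - x1) by apply/tprojP; rewrite x1p.
set k := x - x1 in kZ; have xk : x - k = x1 by rewrite opprB addrCA subrr addr0.
have shift_near (P : E -> Prop) : (\forall y \near x1, P y) -> \forall y \near x, P (y - k).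
  by move/(near_translate k); rewrite [x1 + k]addrC subrK.
pose F2 (y : E) := F1 (y - k).
have cF1 : {for x, continuous F2}.
  apply/continuous_dist => e e0; rewrite /F2 xk.
  apply: (shift_near (fun y => `|F1 y - F1 x1| <= e)).
  exact: (continuous_dist F1 x1).1 (differentiable_continuous dF1) e e0.
have FF1 : \forall y \near x, tproj (F y) = tproj (F2 y).
  apply: filterS (shift_near _ F1f) => y ->.
  by rewrite Ff tprojD//; exact: int_vectorN.
have near_eq := lifts_near (@cF x) cF1 FF1.
have [dF dE] : differentiable F x /\ 'd F x = 'd F1 x1 :> (_ -> _).
  apply: diff_of_approx; first exact: diff_continuous.
  move=> eps eps0; have H := shift_near _ (differentiable_approx dF1 eps0).
  apply: filterS2 near_eq H => y Fy.
  have -> : F y - F x = F1 (y - k) - F1 x1.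
    move/eqP: Fy; rewrite /F2 xk subr_eq => /eqP ->.
    by apply/rowP => i; rewrite !mxE; ring.
  have -> : y - k - x1 = y - x by rewrite /k; apply/rowP => i; rewrite !mxE; ring.
  by [].
split; first exact: dF.
move=> v; have JE : 'd F1 x1 v = v *m A.
  by rewrite -JF1 /jacobian mul_rV_lin1.
exact: (etrans (congr1 (fun h : E -> E => h v) dE) JE).
Qed.

Lemma tangent_map_continuous (f : T -> T) (Df : T -> 'M[R]_m) :
  (forall p, is_tangent_map f p (Df p)) -> continuous f.
Proof.
move=> Hf; apply/quotient_continuous => x U /= Ux.
have [x1 [F1 [x1p F1f dF1 _]]] := Hf (tproj x).
have kZ : int_vector (x - x1) by apply/tprojP; rewrite x1p.
suff : \forall y \near x1, U (f (tproj y)).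
  rewrite -[x](subrK x1) [x - x1 + x1]addrC.
  move=> /(near_translate (x - x1)); apply: filterS => y /=.
  by rewrite tprojD//; exact: int_vectorN.
have H : \forall y \near x1, U (tproj (F1 y)).
  have c : {for x1, continuous (@tproj R m \o F1)}.
    by apply: continuous_comp; [exact: differentiable_continuous|exact: tproj_continuous].
  apply: c; rewrite /= (nbhs_singleton F1f) x1p; exact: Ux.
by apply: filterS2 F1f H => y <-.
Qed.

End Tangent.

Lemma continuous_sum (R : realType) (T : topologicalType) (I : finType) (F : I -> T -> R) :
  (forall i, continuous (F i)) -> continuous (fun x => \sum_i F i x).
Proof.
move=> cF; have -> : (fun x => \sum_i F i x) = \sum_i F i.
  by apply/funext => x; rewrite fct_sumE.
elim/big_ind: _ => //; first by move=> x; exact: cvg_cst.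
by move=> f g cf cg x; apply: cvgD; [exact: cf|exact: cg].
Qed.

Lemma continuous_mul (R : realType) (T : topologicalType) (f g : T -> R) :
  continuous f -> continuous g -> continuous (fun x => f x * g x).
Proof. by move=> cf cg x; apply: cvgM; [exact: cf|exact: cg]. Qed.

(** * Comparison of the Riemannian metric with the coordinate norm *)

Section Metric.
Variables (R : realType) (m : nat).
Local Notation E := 'rV[R]_m.
Local Notation T := (torus R m).
Variable G : T -> 'M[R]_m.
Hypothesis G_metric : riemannian_metric G.

Definition rquad (x v : E) : R := (v *m G (tproj x) *m v^T) ord0 ord0.

Lemma rquad_continuous : continuous (fun u : E * E => rquad u.1 u.2).
Proof.
have [G0 _ _] := G_metric.
have -> : (fun u : E * E => rquad u.1 u.2) = (fun u => \sum_j
    (\sum_k u.2 ord0 k * G (tproj u.1) k j) * u.2 ord0 j).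
  apply/funext => u; rewrite /rquad mxE; apply: eq_bigr => j _.
  by rewrite !mxE.
have c2 k : continuous (fun u : E * E => u.2 ord0 k).
  move=> u; apply: (@continuous_comp _ _ _ snd (fun v : E => v ord0 k)).
    exact: cvg_snd.
  exact: coord_continuous.
apply: continuous_sum => j; apply: continuous_mul; last exact: c2.
apply: continuous_sum => k; apply: continuous_mul; first exact: c2.
move=> u; apply: (@continuous_comp _ _ _ fst (fun x : E => G (tproj x) k j)).
  exact: cvg_fst.
exact: (G0 0 k j).
Qed.

Lemma rquadZ x a v : rquad x (a *: v) = a ^+ 2 * rquad x v.
Proof.
rewrite /rquad -scalemxAl linearZ/= -scalemxAr -scalemxAl !mxE.
by rewrite mulrA expr2.
Qed.

Lemma rquad_gt0 x v : v != 0 -> 0 < rquad x v.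
Proof. by have [_ _ H] := G_metric; exact: H. Qed.

Lemma rnorm_tproj x v : rnorm G (tproj x) v = Num.sqrt (rquad x v).
Proof. by []. Qed.

Lemma rnorm_bounds : exists c1 c2, [/\ 0 < c1, 0 < c2 &
  forall p v, c1 * `|v| <= rnorm G p v <= c2 * `|v|].
Proof.
(* In dimension 0 there is no unit vector over which to minimise. *)
have [[v0 v0n]|no] := pselect (exists v : E, v != 0); last first.
  exists 1, 1; split => // p v; have -> : v = 0.
    by apply/eqP/negPn/negP => h; apply: no; exists v.
  by rewrite normr0 mulr0 /rnorm mul0mx mul0mx mxE sqrtr0 lexx.
pose Q : set (E * E) := (setT `&` [set x | `|x - 0| <= 1]) `*`
  ([set v | 1 <= `|v - 0|] `&` [set v | `|v - 0| <= 1]).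
have Q_compact : compact Q.
  apply: compact_setX; apply: compact_closed_ball; first exact: closedT.
  apply: (@closed_le_fun _ E (fun=> 1)); first exact: cst_continuous.
  by apply: (@continuous_norm_sub _ E E id) => x; exact: cvg_id.
have Q0 : Q !=set0.
  have n1 : `| (`|v0|^-1 *: v0) - 0| = 1.
    by rewrite subr0 normrZ normfV normr_id mulVf ?normr_eq0.
  exists (0, `|v0|^-1 *: v0); rewrite /Q/= n1 subr0 normr0.
  by split; split=> //=; rewrite lexx.
have cq := @continuous_subspaceT _ _ Q _ rquad_continuous.
have [[xm vm]] := compact_EVT_min Q0 Q_compact cq.
have [[xM vM]] := compact_EVT_max Q0 Q_compact cq.
rewrite !inE /= => -[[_ _] [/= vM1 _]] HM [[_ _] [/= vm1 _]] Hm.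
have nz (v : E) : 1 <= `|v - 0| -> v != 0.
  by rewrite subr0; apply: contraTneq => ->; rewrite normr0 ler10.
exists (Num.sqrt (rquad xm vm)), (Num.sqrt (rquad xM vM)).
split; rewrite ?sqrtr_gt0 ?rquad_gt0 ?nz// => p v.
have [->|vn] := eqVneq v 0.
  by rewrite normr0 !mulr0 /rnorm mul0mx mul0mx mxE sqrtr0 lexx.
have [x0 <-] := tproj_surj p; have [k kZ xk] := int_vector_cube x0.
rewrite -(tprojD x0 kZ) rnorm_tproj; set x := x0 + k in xk *.
have v_gt0 : 0 < `|v| by rewrite normr_gt0.
pose u := `|v|^-1 *: v.
have u1 : `|u| = 1 by rewrite normrZ normfV normr_id mulVf ?normr_eq0.
have Qu : (x, u) \in Q.
  by rewrite inE /Q/= !subr0 u1; split; split=> //=; rewrite lexx.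
have qE : rquad x v = `|v| ^+ 2 * rquad x u.
  by rewrite -rquadZ /u scalerA divff ?normr_eq0// scale1r.
rewrite qE sqrtrM ?sqr_ge0// sqrtr_sqr normr_id.
have [h1 h2] := (Hm _ Qu, HM _ Qu); rewrite /= in h1 h2.
have un : u != 0 by rewrite -normr_eq0 u1 oner_eq0.
have q0 : 0 <= rquad x u by rewrite ltW// rquad_gt0.
have qM : 0 <= rquad xM vM by rewrite ltW// rquad_gt0// nz.
by rewrite ![_ * `|v|]mulrC !ler_pM2l// !ler_sqrt// h1 h2.
Qed.

(** The metric norm of a vector of [B] does not grow along the orbit, so the comparison with the
    coordinate norm is paid only at the two ends. Hence the constant [c2 / c1], independent of
    [j]. *)
Lemma iterate_bound (f : T -> T) (F : E -> E) (Df : T -> 'M[R]_m)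
    (B : T -> {vspace E}) :
  (forall x, differentiable F x /\ forall v, 'd F x v = v *m Df (tproj x)) ->
  (forall x, tproj (F x) = f (tproj x)) ->
  (forall p v, v \in B p -> v *m Df p \in B (f p)) ->
  (forall p v, v \in B p -> rnorm G (f p) (v *m Df p) <= rnorm G p v) ->
  (forall j x, differentiable (iter j F) x) /\
  exists2 C, 0 < C & forall j x e, e \in B (tproj x) ->
    `|'d (iter j F) x e| <= C * `|e|.
Proof.
move=> dF Ff Binv Bcontr.
have dI j x : differentiable (iter j F) x.
  elim: j => [|j IH]; first exact: ex_diff.
  by apply: (@differentiable_comp _ _ _ _ (iter j F) F) => //; have [] := dF (iter j F x).
split => //; have [c1 [c2 [c10 c20 H]]] := rnorm_bounds.
exists (c2 / c1); first by rewrite divr_gt0.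
move=> j x e eB.
suff [_ Hj] : 'd (iter j F) x e \in B (tproj (iter j F x)) /\
    rnorm G (tproj (iter j F x)) ('d (iter j F) x e) <= rnorm G (tproj x) e.
  rewrite mulrAC ler_pdivlMr// mulrC.
  have /andP[h1 _] := H (tproj (iter j F x)) ('d (iter j F) x e).
  have /andP[_ h2] := H (tproj x) e.
  exact: le_trans h1 (le_trans Hj h2).
elim: j => [|j [IH1 IH2]].
  have -> : 'd (iter 0 F) x e = e by rewrite (diff_val (f := @id E)).
  by [].
have [dFj dFjE] := dF (iter j F x).
have -> : 'd (iter j.+1 F) x e = 'd (iter j F) x e *m Df (tproj (iter j F x)).
  rewrite -dFjE.
  exact: (congr1 (fun h : E -> E => h e) (diff_comp (dI j x) dFj)).
rewrite iterS Ff; split; first exact: Binv.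
by rewrite (le_trans (Bcontr _ _ IH1)).
Qed.

End Metric.

(** * Compact immersed submanifolds *)

Section StrictDifferentiability.
Variable R : realType.

Lemma is_derive_approx (g : R -> R) (a t : R) :
  (forall eps, 0 < eps -> \forall s \near t, `|g s - g t - a * (s - t)| <= eps * `|s - t|) ->
  is_derive t 1 g a.
Proof.
move=> H.
have lim : h^-1 *: (g (h *: 1 + t) - g t) @[h --> 0^'] --> a.
  apply/cvgrPdist_le => eps eps0.
  have := H _ eps0; rewrite [X in X -> _](near_shift 0 t) => Hs.
  near=> h.
  have h0 : h != 0 by near: h; exact: nbhs_dnbhs_neq.
  have h1 : `|g (h + t) - g t - a * h| <= eps * `|h|.
    suff : `|g (h + t) - g t - a * ((h + t) - t)| <= eps * `|(h + t) - t|.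
      by rewrite addrK.
    near: h; apply: nbhs_dnbhs; apply: filterS Hs => h /=.
    by rewrite subr0.
  have -> : a - h^-1 *: (g (h *: 1 + t) - g t) = - (h^-1 * (g (h + t) - g t - a * h)).
    have -> : h *: (1 : R) = h by exact: mulr1.
    rewrite -[_ *: _]/(h^-1 * (g (h + t) - g t)); field; exact: h0.
  by rewrite normrN normrM normfV mulrC ler_pdivrMr ?normr_gt0.
apply: DeriveDef; first by apply/cvg_ex; exists a.
exact: cvg_lim lim.
Unshelve. all: by end_near. Qed.

Lemma norm_le_coord (m : nat) (v : 'rV[R]_m) c : 0 <= c ->
  (forall k, `|v ord0 k| <= c) -> `|v| <= c.
Proof.
move=> c0 H; rewrite [leLHS]mx_normrE; apply/bigmax_leP; split=> //= -[i j] _ /=.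
by rewrite (ord1 i).
Qed.

Lemma norm_mulmx (d p : nat) (w : 'rV[R]_d) (M : 'M[R]_(d, p)) :
  `|w *m M| <= d%:R * `|w| * `|M|.
Proof.
apply: norm_le_coord => [|k]; first by rewrite !mulr_ge0.
rewrite mxE (le_trans (ler_norm_sum _ _ _))//.
apply: (@le_trans _ _ (\sum_(j < d) `|w| * `|M|)).
  apply: ler_sum => j _; rewrite normrM ler_pM ?le_coord//.
  rewrite [leRHS]mx_normrE.
  exact: (le_bigmax _ (fun ij => `|M ij.1 ij.2|) (j, k)).
by rewrite sumr_const card_ord mulr_natl mulrnAl.
Qed.

Lemma diff_jacobian (d p : nat) (phi : 'rV[R]_d -> 'rV[R]_p) v w :
  'd phi v w = w *m 'J phi v.
Proof. by rewrite /jacobian mul_rV_lin1. Qed.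

Lemma secant_coord (p : nat) (x y a b : 'rV[R]_p) (s t : R) i :
  x ord0 i - s * b ord0 i - (y ord0 i - t * b ord0 i) - (a - b) ord0 i * (s - t)
    = (x - y - (s - t) *: a) ord0 i.
Proof. by rewrite !mxE; ring. Qed.

(** The mean value theorem is applied to each coordinate of [phi] minus its linear part along the
    segment from [v'] to [v]. Uniformity in both points is what controls secants of the
    submanifold. *)
Lemma strict_differentiability (d p : nat) (V : set 'rV[R]_d)
    (phi : 'rV[R]_d -> 'rV[R]_p) (v0 : 'rV[R]_d) :
  open V -> V v0 -> C1_on V phi -> forall eps, 0 < eps ->
  exists2 r, 0 < r & forall v v', `|v - v0| < r -> `|v' - v0| < r ->
    `|phi v - phi v' - (v - v') *m 'J phi v0| <= eps * `|v - v'|.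
Proof.
move=> oV Vv0 C1 eps eps0.
have [_ cJ] := C1 v0 Vv0.
(* [norm_mulmx] loses a factor [d]; [d.+1] absorbs it and is positive even for [d = 0]. *)
have d0 : 0 < d.+1%:R :> R by rewrite ltr0n.
have nearV : \forall v \near v0, V v by apply: open_nbhs_nbhs.
have nearJ := (continuous_dist (jacobian phi) v0).1 cJ _ (divr_gt0 eps0 d0).
have [r r0 H] : exists2 r, 0 < r & forall v : 'rV[R]_d, `|v - v0| <= r ->
    V v /\ `|'J phi v - 'J phi v0| <= eps / d.+1%:R.
  by apply: near_radius; apply: filterS2 nearV nearJ.
exists r => // v v' vr v'r; set w := v - v'.
apply: norm_le_coord => [|i]; first by rewrite mulr_ge0// ltW.
pose l (t : R) := v' + t *: w.
have lr t : 0 <= t <= 1 -> `|l t - v0| <= r.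
  move=> /andP[t0 t1].
  have -> : l t - v0 = (1 - t) *: (v' - v0) + t *: (v - v0).
    by rewrite /l /w; apply/rowP => k; rewrite !mxE; ring.
  rewrite (le_trans (ler_normD _ _))// !normrZ !ger0_norm ?subr_ge0//.
  have h1 : (1 - t) * `|v' - v0| <= (1 - t) * r by rewrite ler_wpM2l ?subr_ge0// ltW.
  have h2 : t * `|v - v0| <= t * r by rewrite ler_wpM2l// ltW.
  by move: h1 h2; drop_ineqs; lra.
pose g (t : R) := phi (l t) ord0 i - t * (w *m 'J phi v0) ord0 i.
pose dg (t : R) := (w *m ('J phi (l t) - 'J phi v0)) ord0 i.
have g_derive (t : R) : 0 <= t <= 1 -> is_derive t 1 g (dg t).
  move=> t01; have [Vl _] := H _ (lr _ t01); have [dphi _] := C1 _ Vl.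
  apply: is_derive_approx => e e0.
  have w0 : 0 < 1 + `|w| by rewrite ltr_pwDl.
  have Happ := differentiable_approx dphi (divr_gt0 e0 w0).
  have cl : l s @[s --> t] --> l t.
    by apply: cvgD; [exact: cvg_cst|exact: scalel_continuous].
  have Hs : \forall s \near t, `|phi (l s) - phi (l t) - 'd phi (l t) (l s - l t)|
      <= e / (1 + `|w|) * `|l s - l t| by exact: cl _ Happ.
  apply: filterS Hs => s.
  have -> : l s - l t = (s - t) *: w.
    by rewrite /l; apply/rowP => k; rewrite !mxE; ring.
  rewrite diff_jacobian normrZ => Hs.
  have -> : g s - g t - dg t * (s - t) =
      (phi (l s) - phi (l t) - ((s - t) *: w) *m 'J phi (l t)) ord0 i.
    by rewrite /g /dg mulmxBr -scalemxAl; exact: secant_coord.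
  rewrite (le_trans (le_coord _ _))// (le_trans Hs)//.
  rewrite -!mulrA ler_wpM2l ?(ltW e0)// mulrA mulrAC mulrC ler_piMr//.
  by rewrite mulrC ler_pdivrMr// mul1r lerDr.
have [c /[!in_itv]/= c01] : exists2 c, c \in `]0, 1[%R & g 1 - g 0 = dg c * (1 - 0).
  apply: MVT => //.
    by move=> t; rewrite in_itv/= => /andP[t0 t1]; apply: g_derive; rewrite !ltW.
  apply: derivable_within_continuous => t; rewrite in_itv/= => t01.
  by have [] := g_derive t t01.
have -> : g 1 - g 0 = (phi v - phi v' - w *m 'J phi v0) ord0 i.
  rewrite /g /l scale1r scale0r addr0 mul0r mul1r subr0 [v' + w]addrC subrK.
  have coordB (x y a : 'rV[R]_p) :
      x ord0 i - a ord0 i - y ord0 i = (x - y - a) ord0 i.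
    by rewrite !mxE; ring.
  exact: coordB.
rewrite subr0 mulr1 => ->.
have [_ HJ] : V (l c) /\ `|'J phi (l c) - 'J phi v0| <= eps / d.+1%:R.
  by apply: H; apply: lr; case/andP: c01 => h1 h2; rewrite !ltW.
rewrite /dg (le_trans (le_coord _ _))// (le_trans (norm_mulmx _ _))//.
apply: (@le_trans _ _ (d.+1%:R * `|w| * (eps / d.+1%:R))).
  by rewrite ler_pM// ?mulr_ge0// ler_wpM2r// ler_nat.
by rewrite mulrAC [d.+1%:R * _]mulrCA divff ?lt0r_neq0// mulr1.
Qed.

End StrictDifferentiability.

Section Submanifold.
Variables (R : realType) (m d : nat).
Local Notation E := 'rV[R]_m.
Local Notation T := (torus R m).
Variables (S : topologicalType) (iota : S -> T).
Hypothesis S_immersed : immersed_submanifold d iota.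

Lemma immersed_continuous : continuous iota.
Proof.
have [_ _ charts] := S_immersed.
move=> s U /= Us; have [V [h [phi [[[oV ch] _ hop phiE [C1 _]] [v Vv hv]]]]] := charts s.
have [dphi _] := C1 v Vv.
have c : {for v, continuous (@tproj R m \o phi)}.
  by apply: continuous_comp; [exact: differentiable_continuous|exact: tproj_continuous].
have nV : nbhs v V by apply: open_nbhs_nbhs.
have nU : nbhs v (fun w => U (tproj (phi w))).
  by apply: c; rewrite /= phiE// hv.
pose O' := interior (V `&` (fun w => U (tproj (phi w)))).
have sO : nbhs s (h @` O').
  apply: open_nbhs_nbhs; split; last by exists v => //; exact: filterI nV nU.
  apply: hop; first exact: open_interior.
  by move=> w /interior_subset[].
apply: filterS sO => _ [w /interior_subset[Vw Uw] <-].
by rewrite /= -phiE.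
Qed.

Lemma chart_at (z : E) : range iota (tproj z) -> exists (V : set 'rV[R]_d) (h : 'rV[R]_d -> S)
    (phi : 'rV[R]_d -> E) v0 k, [/\ immersed_chart iota V h phi, V v0, phi v0 + k = z, int_vector k &
      iota (h v0) = tproj z].
Proof.
have [_ _ charts] := S_immersed.
move=> [s _ sz]; have [V [h [phi [chart [v0 Vv0 hv0]]]]] := charts s.
have [_ _ _ phiE _] := chart.
exists V, h, phi, v0, (z - phi v0); split => //.
- by rewrite addrC subrK.
- by apply/tprojP; rewrite phiE// hv0.
- by rewrite hv0.
Qed.

Variable B : T -> {vspace E}.
Hypothesis S_tangent : tangent_to d iota B.

Lemma chart_image (V : set 'rV[R]_d) (h : 'rV[R]_d -> S) (phi : 'rV[R]_d -> E) v (e : E) : immersed_chart iota V h phi -> V v ->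
  (e \in B (iota (h v))) <-> exists xi, e = xi *m 'J phi v.
Proof.
move=> chart Vv; rewrite -(S_tangent chart Vv).
split=> [/memv_imgP[xi _ ->]|[xi ->]]; first by exists xi; rewrite lfunE.
by apply/memv_imgP; exists xi; rewrite ?memvf// lfunE.
Qed.

Lemma chart_curve (V : set 'rV[R]_d) (h : 'rV[R]_d -> S) (phi : 'rV[R]_d -> E) v k (e : E) : immersed_chart iota V h phi -> V v ->
  e \in B (iota (h v)) -> exists2 c : R -> 'rV[R]_d,
    tangent_curve (fun t => phi (c t) + k) (phi v + k) e &
    c t @[t --> 0^'+] --> v.
Proof.
move=> chart Vv /(chart_image _ chart Vv)[xi eE].
have [_ _ _ _ [C1 _]] := chart; have [dphi _] := C1 v Vv.
exists (fun t => v + t *: xi); last exact: (tangent_curve_cvg (tangent_curve_line v xi)).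
move=> eps eps0; have := tangent_curve_comp dphi (tangent_curve_line v xi) eps0.
apply: filterS => t /=; rewrite diff_jacobian -eE.
by rewrite [phi v + k]addrC opprD addrA addrK.
Qed.

Lemma submanifold_tangent (z e : E) : range iota (tproj z) -> e \in B (tproj z) ->
  exists2 c, tangent_curve c z e & \forall t \near 0^'+, range iota (tproj (c t)).
Proof.
move=> /chart_at[V [h [phi [v0 [k [chart Vv0 <- kZ iz]]]]]] eB.
rewrite -iz in eB.
have [c ce cv] := chart_curve k chart Vv0 eB.
exists (fun t => phi (c t) + k) => //.
have [[oV _] _ _ phiE _] := chart.
have nV : nbhs v0 V by apply: open_nbhs_nbhs.
have := cv _ nV; rewrite /= => H.
by near=> t; exists (h (c t)) => //; rewrite -phiE ?tprojD//; near: t.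
Unshelve. all: by end_near. Qed.

Hypothesis S_compact : compact [set: S].

Definition submanifold_cover := [set z : E | range iota (tproj z)].

Lemma submanifold_cover_closed : closed submanifold_cover.
Proof.
have : closed (range iota).
  apply: compact_closed; first exact: torus_hausdorff.
  by apply: continuous_compact => //; apply: continuous_subspaceT; exact: immersed_continuous.
by apply: preimage_closed => x _; exact: tproj_continuous.
Qed.

(** An injective immersion of a compact space is an embedding: the image of the complement of the
    chart neighbourhood is compact and misses the point, so no other sheet of the submanifold
    accumulates there. *)
Lemma submanifold_chart_near (V : set 'rV[R]_d) (h : 'rV[R]_d -> S) (phi : 'rV[R]_d -> E) v0 (k : E) : immersed_chart iota V h phi ->
  V v0 -> int_vector k -> forall r, 0 < r ->
  \forall z \near phi v0 + k, submanifold_cover z ->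
    exists v, [/\ V v, `|v - v0| < r & z = phi v + k].
Proof.
move=> chart Vv0 kZ r r0.
have [[oV _] inj hop phiE [C1 _]] := chart; have [dphi _] := C1 v0 Vv0.
have nV : nbhs v0 V by apply: open_nbhs_nbhs.
have nphi := (continuous_dist phi v0).1 (differentiable_continuous dphi) 4^-1 ltac:(by []).
have n0 : \forall v \near v0, [/\ V v, `|v - v0| < r & `|phi v - phi v0| <= 4^-1].
  by apply: filterS3 nV (near_dist v0 r0) nphi.
pose O' := interior [set v | [/\ V v, `|v - v0| < r & `|phi v - phi v0| <= 4^-1]].
have O'P v : O' v -> [/\ V v, `|v - v0| < r & `|phi v - phi v0| <= 4^-1].
  exact: interior_subset.
have hO : open (h @` O').
  by apply: hop; [exact: open_interior|move=> v /O'P[]].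
have C_closed : closed (iota @` ~` (h @` O')).
  apply: compact_closed; first exact: torus_hausdorff.
  apply: continuous_compact.
    by apply: continuous_subspaceT; exact: immersed_continuous.
  apply: (subclosed_compact _ S_compact) => //.
  exact: open_closedC.
have pC : ~ (iota @` ~` (h @` O')) (tproj (phi v0 + k)).
  move=> [s sO]; rewrite tprojD// phiE//.
  have [iota_inj _ _] := S_immersed; move=> /iota_inj sE.
  by apply: sO; exists v0.
have nC : \forall z \near phi v0 + k, ~ (iota @` ~` (h @` O')) (tproj z).
  apply/(near_tproj _ (fun p => ~ (iota @` ~` (h @` O')) p)).
  by apply: open_nbhs_nbhs; split => //; exact: closed_openC.
have e2 : 0 < 2^-1 :> R by [].
apply: filterS2 nC (near_dist (phi v0 + k) e2) => z zC zk [s _ sz].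
have [v O'v hv] : (h @` O') s.
  by apply: contrapT => sO; apply: zC; exists s.
have [Vv vr phiv] := O'P v O'v.
(* Both sides lift the same point and are less than [1/2 + 1/4] apart, so they coincide. *)
exists v; split=> //; apply/eqP; rewrite -subr_eq0; apply/eqP/int_vector_small.
  by apply/tprojP; rewrite tprojD// phiE// hv.
have -> : z - (phi v + k) = (z - (phi v0 + k)) - (phi v - phi v0).
  by apply/rowP => i; rewrite !mxE; ring.
rewrite (le_lt_trans (ler_normB _ _))//.
by move: zk phiv; drop_ineqs; lra.
Qed.

(** In a chart, [z - z'] is [w *m J] up to a small multiple of [|w|]. As [q] fixes the tangent
    vector [w *m J] and kills [z - z'], the vector [w *m J] is as small as the error; since [J] has
    full rank, [w = 0]. *)
Lemma submanifold_transverse (p0 : E) (q : 'End(E)) : submanifold_cover p0 ->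
  (forall e, e \in B (tproj p0) -> q e = e) ->
  exists2 rho, 0 < rho & forall z z', submanifold_cover z -> submanifold_cover z' ->
    `|z - p0| <= rho -> `|z' - p0| <= rho -> q (z - z') = 0 -> z = z'.
Proof.
move=> Kp0 qid; have [V [h [phi [v0 [k [chart Vv0 p0E kZ iz]]]]]] := chart_at Kp0.
have [[oV _] _ _ _ [C1 rk]] := chart.
have [Cq Cq0 Hq] := lfun_bound q.
set J := 'J phi v0.
have Jfree : row_free J by rewrite /row_free rk.
(* [a] bounds the loss in recovering [w] from [w *m J] through [pinvmx J], together with the norm of
   [q]; [eps] is chosen so that [a * eps <= 1/2]. *)
pose a := m%:R * `|pinvmx J| * Cq.
have a0 : 0 <= a by rewrite !mulr_ge0// ltW.
have a1 : 0 < 1 + 2 * a by move: a0; drop_ineqs; lra.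
pose eps := (1 + 2 * a)^-1; have eps0 : 0 < eps by rewrite invr_gt0.
have aeps : a * eps <= 2^-1.
  by rewrite ler_pdivrMr//; move: a0; drop_ineqs; lra.
have [r r0 H] := strict_differentiability oV Vv0 C1 eps0.
have := submanifold_chart_near chart Vv0 kZ r0; rewrite p0E.
move=> /near_radius[rho rho0 near]; exists rho => // z z' Kz Kz' zr z'r qz.
have [v [Vv vr zE]] := near z zr Kz; have [v' [Vv' v'r z'E]] := near z' z'r Kz'.
pose w := v - v'.
have zz' : z - z' = phi v - phi v'.
  by rewrite zE z'E; apply/rowP => i; rewrite !mxE; ring.
have wJB : q (w *m J) = w *m J.
  by apply: qid; rewrite -iz; apply/(chart_image _ chart Vv0); exists w.
have wJ : `|w *m J| <= Cq * (eps * `|w|).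
  have -> : w *m J = - q (phi v - phi v' - w *m J).
    by rewrite (linearB q (phi v - phi v'))/= -zz' qz wJB sub0r opprK.
  by rewrite normrN (le_trans (Hq _))// ler_wpM2l ?(ltW Cq0)// H.
have w_small : `|w| <= 2^-1 * `|w|.
  rewrite -{1}(mulmxKp Jfree w) (le_trans (norm_mulmx _ _))//.
  have h1 := ler_wpM2r (normr_ge0 w) aeps.
  have h2 : m%:R * `|pinvmx J| * `|w *m J| <= m%:R * `|pinvmx J| * (Cq * (eps * `|w|)).
    by rewrite ler_wpM2l// mulr_ge0.
  by move: h1 h2; rewrite /a; drop_ineqs; lra.
have w0 : w = 0.
  apply/eqP; rewrite -normr_le0; move: w_small (normr_ge0 w); drop_ineqs; lra.
by rewrite zE z'E; congr (phi _ + _); apply/eqP; rewrite -subr_eq0 -/w w0.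
Qed.

End Submanifold.

(** * The leaf conjugacy and its linear part *)

Section Hyperbolic.
Variables (R : realType) (m : nat).
Local Notation E := 'rV[R]_m.
Local Notation T := (torus R m).

Lemma ph_lift (f : T -> T) (Es Ec Eu : T -> {vspace E}) :
  partially_hyperbolic f Es Ec Eu -> exists (g : T -> T) (F Fi : E -> E)
    (Df Dg G : T -> 'M[R]_m) (lam : R),
  [/\ [/\ cancel F Fi, cancel Fi F, continuous F & continuous Fi],
      (forall x, tproj (F x) = f (tproj x)) /\ (forall x, tproj (Fi x) = g (tproj x)),
      (forall x, differentiable F x /\ forall v : E, 'd F x v = v *m Df (tproj x)) /\
      (forall x, differentiable Fi x /\ forall v : E, 'd Fi x v = v *m Dg (tproj x)),
      [/\ forall p v, v \in Es p -> v *m Df p \in Es (f p),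
          forall p v, v \in Ec p -> v *m Df p \in Ec (f p),
          forall p v, v \in Eu p -> v *m Df p \in Eu (f p),
          forall p v, v \in Eu p -> v *m Dg p \in Eu (g p) &
          forall x (v : E), v *m Df (tproj x) *m Dg (tproj (F x)) = v] &
      [/\ riemannian_metric G, 0 <= lam < 1,
          forall p v, v \in Es p -> rnorm G (f p) (v *m Df p) <= lam * rnorm G p v &
          forall p v, v \in Eu p -> rnorm G (g p) (v *m Dg p) <= lam * rnorm G p v]].
Proof.
move=> [g [Df [Dg [[fK gK [_ Tf] [_ Tg]] [[_ invS] [_ invC] [_ invU]] _ _]]]].
move=> [G Gm [[l1 l11 c1] [l2 l21 c2] _]].
have cf := tangent_map_continuous Tf; have cg := tangent_map_continuous Tg.
have [F [Fi [FK FiK cF cFi [Ff Fg]]]] := homeo_lift fK gK cf cg.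
have dF x := tangent_map_lift cF Ff (Tf (tproj x)) (erefl (tproj x)).
have dFi x := tangent_map_lift cFi Fg (Tg (tproj x)) (erefl (tproj x)).
have inv (B : T -> {vspace E}) :
    (forall p, (linfun (mulmxr (Df p)) @: B p)%VS = B (f p)) ->
    forall p v, v \in B p -> v *m Df p \in B (f p).
  move=> H p v vB; rewrite -H; have := memv_img (linfun (mulmxr (Df p))) vB.
  by rewrite lfunE.
have DfDg x (v : E) : v *m Df (tproj x) *m Dg (tproj (F x)) = v.
  have [dFx FE] := dF x; have [dFiF FiE] := dFi (F x).
  apply: (etrans (esym (FiE _))).
  apply: (etrans (congr1 ('d Fi (F x)) (esym (FE v)))).
  have dE := congr1 (fun h : E -> E => h v) (diff_comp dFx dFiF).
  apply: (etrans (esym dE)) => /=.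
  have -> : Fi \o F = id by apply/funext.
  exact: (congr1 (fun h : E -> E => h v) (diff_val (f := @id E))).
have ge0 (p : T) v : 0 <= rnorm G p v by exact: sqrtr_ge0.
(* The contraction constants of the definition carry no sign; taking the maximum with 0 allows
   powers of [lam] to be compared. *)
exists g, F, Fi, Df, Dg, G, (Num.max 0 (Num.max l1 l2)); split => //.
- split=> //; [exact: inv|exact: inv|exact: inv|].
  (* A vector of [Eu p] is the image under [Df] of a vector of [Eu (g p)], and [Dg] undoes [Df]. *)
  move=> p v; rewrite -{1}[p]gK -invU => /memv_imgP[w wu ->]; rewrite lfunE/=.
  have [x xp] := tproj_surj (g p).
  by rewrite -xp in wu *; rewrite -[p in Dg p]gK -xp -Ff DfDg.
- split=> //.
  + by rewrite le_max lexx /= !gt_max ltr01 l11.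
  + move=> p v vs; rewrite (le_trans (c1 p v vs))// ler_wpM2r//.
    by rewrite !le_max lexx orbT.
  + move=> p v vs; rewrite (le_trans (c2 p v vs))// ler_wpM2r//.
    by rewrite !le_max lexx !orbT.
Qed.

Lemma int_vector_mulmx (A : 'M[int]_m) (k : E) :
  int_vector k -> int_vector (k *m map_mx intr A).
Proof.
move=> kZ i; rewrite mxE; apply: rpred_sum => j _; rewrite mxE.
by rewrite rpredM// intr_int.
Qed.

Lemma toral_map_tproj (A : 'M[int]_m) (z : E) :
  toral_map A (tproj z) = tproj (z *m map_mx intr A).
Proof.
rewrite /toral_map; apply/tprojP; rewrite -mulmxBl; apply: int_vector_mulmx.
by apply/tprojP; rewrite tproj_repr.
Qed.

Lemma mulmx_continuous (M : 'M[R]_m) : continuous (fun v : E => v *m M).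
Proof.
have -> : (fun v : E => v *m M) = (linfun (mulmxr M) : 'Hom(E, E)).
  by apply/funext => v; rewrite lfunE.
exact: lfun_continuous.
Qed.

(** The point [tproj 0] is fixed, so the metric there provides one norm [N] for which [M] contracts
    [Ls] and expands [Lu] in a single step. *)
Lemma toral_hyperbolic (A : 'M[int]_m) (Ls Lc Lu : {vspace E}) :
  partially_hyperbolic (toral_map A) (fun=> Ls) (fun=> Lc) (fun=> Lu) ->
  let M : 'M[R]_m := map_mx intr A in exists (N : E -> R) (c1 c2 lam : R),
  [/\ [/\ 0 < c1, 0 < c2 & forall v, c1 * `|v| <= N v <= c2 * `|v|],
      0 <= lam < 1,
      (forall v : E, v *m M = 0 -> v = 0),
      [/\ forall v, v \in Ls -> v *m M \in Ls,
          forall v, v \in Lc -> v *m M \in Lc &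
          forall v, v \in Lu -> v *m M \in Lu] &
      (forall v, v \in Ls -> N (v *m M) <= lam * N v) /\
      (forall v, v \in Lu -> N v <= lam * N (v *m M))].
Proof.
move=> ph M; have [g [F [Fi [Df [Dg [G [lam H]]]]]]] := ph_lift ph.
case: H => [[FK FiK cF cFi] [Ff Fg] [dF dFi] [invS invC invU _ DfDg]].
move=> [Gm lam01 cs cu].
(* A lift of the toral map is [M] followed by a translation, so the tangent map, known only through
   local lifts, acts as [M] at every point. *)
have FM : exists2 k, int_vector k & forall x, F x = x *m M + k.
  apply: lift_unique => //; first exact: mulmx_continuous.
  by move=> x; rewrite Ff toral_map_tproj.
have DfE x (v : E) : v *m Df (tproj x) = v *m M.
  have [dFx <-] := dF x.
  have [k _ kP] := FM.
  have [_ dE] : differentiable F x /\ 'd F x = (linfun (mulmxr M) : 'Hom(E, E)) :> (_ -> _).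
    apply: diff_of_approx; first exact: lfun_continuous.
    move=> eps eps0; near=> y.
    rewrite [X in `|_ - X|](_ : _ = (y - x) *m M); last exact: lfunE.
    rewrite !kP mulmxBl.
    by rewrite opprD addrACA subrr addr0 subrr normr0 mulr_ge0// ltW.
  by rewrite (congr1 (fun h : E -> E => h v) dE) lfunE.
have f0 : toral_map A (tproj 0) = tproj (0 : E) by rewrite toral_map_tproj mul0mx.
have DgE (v : E) : v *m M *m Dg (tproj 0) = v.
  by have := DfDg 0 v; rewrite DfE Ff f0.
have g0 : g (tproj 0) = tproj 0.
  have F00 : tproj (F 0) = tproj (0 : E) by rewrite Ff f0.
  by rewrite -{1}F00 -Fg FK.
have [c1 [c2 [c10 c20 HN]]] := rnorm_bounds Gm.
exists (rnorm G (tproj 0)), c1, c2, lam; split => //.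
- by move=> v vM; rewrite -[v]DgE vM mul0mx.
- split=> v vB.
  + by rewrite -(DfE 0); exact: invS vB.
  + by rewrite -(DfE 0); exact: invC vB.
  + by rewrite -(DfE 0); exact: invU vB.
- split=> v vB.
  + by have := cs (tproj 0) v vB; rewrite f0 DfE.
  + have vMu : v *m M \in Lu by rewrite -(DfE 0); exact: invU vB.
    by have := cu (tproj 0) _ vMu; rewrite g0 DgE.
Unshelve. all: by end_near. Qed.

Lemma lattice_bounded (psi : E -> E) : continuous psi ->
  (forall k, int_vector k -> exists2 l, int_vector l & forall x, psi (x + k) = psi x + l) ->
  exists2 M, 0 < M & forall x y, `|x - y| <= 1 -> `|psi x - psi y| <= M.
Proof.
move=> cpsi psiZ.
have Q_compact : compact (setT `&` [set x : E | `|x - 0| <= 2]).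
  by apply: compact_closed_ball; exact: closedT.
have [||b _ bP] := @compact_EVT_max _ _ (fun x => `|psi x - 0|) _ _ Q_compact.
- by exists 0; split => //=; rewrite subrr normr0.
- by apply: continuous_subspaceT; exact: (@continuous_norm_sub _ E E psi).
have nb := normr_ge0 (psi b - 0).
exists (1 + `|psi b - 0| + `|psi b - 0|).
  by move: nb; drop_ineqs; lra.
move=> x y xy; have [k kZ xk] := int_vector_cube x.
have [l _ psik] := psiZ k kZ.
have -> : psi x - psi y = (psi (x + k) - 0) - (psi (y + k) - 0).
  by rewrite !psik; apply/rowP => i; rewrite !mxE; ring.
rewrite (le_trans (ler_normB _ _))//.
have h1 : `|psi (x + k) - 0| <= `|psi b - 0|.
  by apply: bP; rewrite inE; split=> //=; rewrite subr0 (le_trans xk)// ler1n.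
have h2 : `|psi (y + k) - 0| <= `|psi b - 0|.
  apply: bP; rewrite inE; split=> //=; rewrite subr0.
  have -> : y + k = (x + k) - (x - y) by apply/rowP => i; rewrite !mxE; ring.
  by rewrite (le_trans (ler_normB _ _))//; move: xk xy; drop_ineqs; lra.
by move: h1 h2; drop_ineqs; lra.
Qed.

End Hyperbolic.

(** * Expansion and contraction seen through the conjugacy *)

Section LinearDynamics.
Variables (R : realType) (m : nat).
Local Notation E := 'rV[R]_m.
Variables (A : 'M[int]_m).
Let M : 'M[R]_m := map_mx intr A.
Variables (N : E -> R) (c1 c2 lam : R) (Ls Lc Lu : {vspace E}) (pS pC pU : 'End(E)).
Hypothesis proj : projections Ls Lc Lu pS pC pU.
Hypothesis c1_gt0 : 0 < c1.
Hypothesis c2_gt0 : 0 < c2.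
Hypothesis N_bounds : forall v, c1 * `|v| <= N v <= c2 * `|v|.
Hypothesis lam01 : 0 <= lam < 1.
Hypothesis M_inj : forall v : E, v *m M = 0 -> v = 0.
Hypothesis Ls_inv : forall v, v \in Ls -> v *m M \in Ls.
Hypothesis Lc_inv : forall v, v \in Lc -> v *m M \in Lc.
Hypothesis Lu_inv : forall v, v \in Lu -> v *m M \in Lu.
Hypothesis Ls_contr : forall v, v \in Ls -> N (v *m M) <= lam * N v.
Hypothesis Lu_exp : forall v, v \in Lu -> N v <= lam * N (v *m M).

Lemma proj_mulmx v : pS (v *m M) = pS v *m M /\ pU (v *m M) = pU v *m M.
Proof.
have [mem sum ids idc idu] := proj; have [s c u] := mem v.
have [s1 _ s3] := ids _ (Ls_inv s); have [c1' _ c3] := idc _ (Lc_inv c).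
have [u1 _ u3] := idu _ (Lu_inv u).
rewrite -{1 3}(sum v) !mulmxDl !linearD/= s1 s3 c1' c3 u1 u3.
by rewrite !addr0 !add0r.
Qed.

Lemma Lc_proj v : (v \in Lc) = (pS v == 0) && (pU v == 0).
Proof.
have [mem sum _ idc _] := proj; have [_ c _] := mem v.
apply/idP/andP=> [/idc[-> _ ->]|[/eqP s0 /eqP u0]]; first by rewrite eqxx.
by rewrite -(sum v) s0 u0 addr0 add0r.
Qed.

Lemma exp_small K e : 0 < e -> exists j, lam ^+ j * K <= e.
Proof.
move=> e0; have /andP[l0 l1] := lam01.
have K0 : 0 < 1 + `|K| by rewrite ltr_pwDl.
have cl : lam ^+ j @[j --> \oo] --> 0 by apply: cvg_expr; rewrite ger0_norm.
have /cvgrPdist_le/(_ _ (divr_gt0 e0 K0))[j _ Hj] := cl.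
exists j; have := Hj j (leqnn j); rewrite /= sub0r normrN ger0_norm ?exprn_ge0//.
rewrite ler_pdivlMr// => h; apply: le_trans h.
by rewrite ler_wpM2l ?exprn_ge0// (le_trans (ler_norm _))// lerDr.
Qed.

Section Conjugacy.
Variables (psi F Fi : E -> E) (Mb : R).
Hypothesis FK : cancel F Fi.
Hypothesis FiK : cancel Fi F.
Hypothesis psi_bounded : forall x y, `|x - y| <= 1 -> `|psi x - psi y| <= Mb.
Hypothesis psi_conj : forall x y,
  psi (F x) - psi (F y) - (psi x - psi y) *m M \in Lc.

Lemma proj_psi x y : pS (psi (F x) - psi (F y)) = pS (psi x - psi y) *m M /\
  pU (psi (F x) - psi (F y)) = pU (psi x - psi y) *m M.
Proof.
have := psi_conj x y; rewrite Lc_proj => /andP[].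
rewrite (linearB pS (psi (F x) - _))/= (linearB pU (psi (F x) - _))/= !subr_eq0.
by have [-> ->] := proj_mulmx (psi x - psi y); move=> /eqP -> /eqP ->.
Qed.

(** Under [F] the unstable coordinate of a difference expands exactly as under [M]. If the j-th
    iterates are within 1, it is still bounded after j steps because [psi] has bounded oscillation
    at scale 1, so initially it was of order [lam ^+ j]. *)
Lemma unstable_separation eps : 0 < eps -> exists j, forall x y,
  `|iter j F x - iter j F y| <= 1 -> `|pU (psi x - psi y)| <= eps.
Proof.
move=> eps0; have [mem _ _ _ _] := proj.
have [C C0 HC] := lfun_bound pU.
have [j Hj] := exp_small (c2 * (C * Mb)) (mulr_gt0 c1_gt0 eps0).
exists j => x y xy; have /andP[l0 _] := lam01.
suff H : N (pU (psi x - psi y)) <= lam ^+ j * N (pU (psi (iter j F x) - psi (iter j F y))).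
  have /andP[h1 _] := N_bounds (pU (psi x - psi y)).
  have /andP[_ h2] := N_bounds (pU (psi (iter j F x) - psi (iter j F y))).
  rewrite -(ler_pM2l c1_gt0) (le_trans h1)// (le_trans H)// (le_trans _ Hj)//.
  rewrite ler_wpM2l ?exprn_ge0// (le_trans h2)// ler_wpM2l ?(ltW c2_gt0)//.
  by rewrite (le_trans (HC _))// ler_wpM2l ?(ltW C0)// psi_bounded.
elim: j {Hj xy} => [|j IH]; first by rewrite expr0 mul1r.
rewrite (le_trans IH)// exprSr -mulrA ler_wpM2l ?exprn_ge0//= .
have [_ ->] := proj_psi (iter j F x) (iter j F y).
by apply: Lu_exp; have [] := mem (psi (iter j F x) - psi (iter j F y)).
Qed.

Lemma stable_separation eps : 0 < eps -> exists j, forall x y,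
  `|iter j Fi x - iter j Fi y| <= 1 -> `|pS (psi x - psi y)| <= eps.
Proof.
move=> eps0; have [mem _ _ _ _] := proj.
have [C C0 HC] := lfun_bound pS.
have [j Hj] := exp_small (c2 * (C * Mb)) (mulr_gt0 c1_gt0 eps0).
exists j => x y xy; have /andP[l0 _] := lam01.
suff H : N (pS (psi x - psi y)) <= lam ^+ j * N (pS (psi (iter j Fi x) - psi (iter j Fi y))).
  have /andP[h1 _] := N_bounds (pS (psi x - psi y)).
  have /andP[_ h2] := N_bounds (pS (psi (iter j Fi x) - psi (iter j Fi y))).
  rewrite -(ler_pM2l c1_gt0) (le_trans h1)// (le_trans H)// (le_trans _ Hj)//.
  rewrite ler_wpM2l ?exprn_ge0// (le_trans h2)// ler_wpM2l ?(ltW c2_gt0)//.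
  by rewrite (le_trans (HC _))// ler_wpM2l ?(ltW C0)// psi_bounded.
elim: j {Hj xy} => [|j IH]; first by rewrite expr0 mul1r.
rewrite (le_trans IH)// exprSr -mulrA ler_wpM2l ?exprn_ge0//= .
rewrite -{1}[iter j Fi x]FiK -{1}[iter j Fi y]FiK.
have [-> _] := proj_psi (Fi (iter j Fi x)) (Fi (iter j Fi y)).
by apply: Ls_contr; have [] := mem (psi (Fi (iter j Fi x)) - psi (Fi (iter j Fi y))).
Qed.

End Conjugacy.

Hypothesis Ls_dim : \dim Ls = 1%N.

(** Some basis vector has a non-zero stable part. Injectivity of [M] keeps this part non-zero along
    the iterates, while contraction makes it shorter than [eps]; the integer multiples of one such
    iterate then have [eps]-dense projections in the line [Ls]. *)
Lemma stable_lattice_dense v eps : 0 < eps ->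
  exists2 k, int_vector k & `|pS v - pS k| <= eps.
Proof.
move=> eps0; have [mem _ ids _ _] := proj; have /andP[l0 _] := lam01.
have s0n : vpick Ls != 0 by rewrite vpick0 -dimv_eq0 Ls_dim.
have [i di] : exists i, pS (delta_mx ord0 i) != 0.
  apply: contrapT => H; case/eqP: s0n.
  have d0 i : pS (delta_mx ord0 i) = 0.
    by apply/eqP/negPn/negP => h; apply: H; exists i.
  have [<- _ _] := ids _ (memv_pick Ls).
  rewrite (row_sum_delta (vpick Ls)) linear_sum/= big1// => i _.
  by rewrite linearZ/= d0 scaler0.
pose k j := iter j (fun w : E => w *m M) (delta_mx ord0 i).
have kZ j : int_vector (k j).
  elim: j => [|j IH]; last exact: int_vector_mulmx.
  by move=> l; rewrite mxE; case: (_ && _); rewrite ?rpred1 ?rpred0.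
have kn j : pS (k j) != 0.
  elim: j => [//|j IH] /=; have [-> _] := proj_mulmx (k j).
  by apply: contra IH => /eqP/M_inj ->.
have kN j : N (pS (k j)) <= lam ^+ j * N (pS (k 0)).
  elim: j => [|j IH]; first by rewrite expr0 mul1r.
  rewrite /= -/(k j); have [-> _] := proj_mulmx (k j).
  have [s _ _] := mem (k j).
  by rewrite (le_trans (Ls_contr s))// exprS -mulrA ler_wpM2l.
have [j Hj] := exp_small (N (pS (k 0))) (mulr_gt0 c1_gt0 eps0).
have tau_small : `|pS (k j)| <= eps.
  have /andP[h1 _] := N_bounds (pS (k j)).
  by rewrite -(ler_pM2l c1_gt0) (le_trans h1)// (le_trans (kN j)).
have [r rE] : exists r, pS v = r *: pS (k j).
  have LsE : Ls = <[pS (k j)]>%VS.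
    apply/esym/eqP; rewrite eqEdim -memvE Ls_dim dim_vline kn.
    by have [-> _ _] := mem (k j).
  by have [] := mem v; rewrite {1}LsE => /vlineP.
exists ((Num.floor r)%:~R *: k j).
  by move=> l; rewrite mxE rpredM// ?kZ// intr_int.
rewrite linearZ/= rE -scalerBl normrZ.
have /andP[h1 h2] := floor_itv r.
rewrite ger0_norm ?subr_ge0//; apply: le_trans tau_small.
by rewrite ler_piMl// lerBlDl ltW// -[1 in X in _ < X]/(1%:~R) -intrD.
Qed.

End LinearDynamics.

(** * Lifted leaves and equivariance of the lifted conjugacy *)

Section LeafConjugacy.
Variables (R : realType) (m : nat).
Local Notation E := 'rV[R]_m.
Local Notation T := (torus R m).
Variables (f psi0 : T -> T) (W : T -> set T) (F psi : E -> E) (A : 'M[int]_m).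
Let M : 'M[R]_m := map_mx intr A.
Variables (Ls Lc Lu : {vspace E}) (pS pC pU : 'End(E)).
Hypothesis proj : projections Ls Lc Lu pS pC pU.
Hypothesis Lc_inv : forall v, v \in Lc -> v *m M \in Lc.
Hypothesis W_refl : forall p, W p p.
Hypothesis psi0_inj : injective psi0.
Hypothesis psi0_W : forall p, psi0 @` W p = linear_leaf Lc (psi0 p).
Hypothesis psi0_f : forall p, psi0 @` (f @` W p) = toral_map A @` (psi0 @` W p).
Hypothesis F_cont : continuous F.
Hypothesis psi_cont : continuous psi.
Hypothesis F_lift : forall x, tproj (F x) = f (tproj x).
Hypothesis psi_lift : forall x, tproj (psi x) = psi0 (tproj x).

Lemma Lc_kernel v : (v \in Lc) = ((\1 - pC)%VF v == 0).
Proof.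
have [mem _ _ idc _] := proj; have [_ c _] := mem v.
rewrite !lfunE/= !lfunE/= subr_eq0; apply/idP/eqP => [/idc[_ -> _]//|->//].
Qed.

Lemma leaf_sub_W p z : leaf psi Lc p z -> W (tproj p) (tproj z).
Proof.
rewrite /leaf/= => zp.
have : (psi0 @` W (tproj p)) (psi0 (tproj z)).
  rewrite psi0_W -!psi_lift; exists (psi p), (psi z - psi p); split => //.
  by rewrite addrC subrK.
by move=> [q Wq /psi0_inj <-].
Qed.

Lemma W_lattice p z : W (tproj p) (tproj z) -> exists k v,
  [/\ int_vector k, v \in Lc & psi z - psi p = k + v].
Proof.
move=> Wz; have : (psi0 @` W (tproj p)) (psi0 (tproj z)) by exists (tproj z).
rewrite psi0_W -!psi_lift => -[x [v [/tprojP xp vL /esym/tprojP zx]]].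
exists (psi z - (x + v) + (x - psi p)), v; split => //; first exact: int_vectorD.
by apply/rowP => i; rewrite !mxE; ring.
Qed.

(** The conjugacy relation holds between leaves of the torus, so modulo [Lc] the defect of
    equivariance is a projected integer vector. It depends continuously on the point and has
    countably many values, hence is constant and cancels in differences. *)
Lemma psi_conjugacy x y : psi (F x) - psi (F y) - (psi x - psi y) *m M \in Lc.
Proof.
set q := (\1 - pC)%VF.
pose u z := q (psi (F z) - psi z *m M).
have cu : continuous u.
  have cd : continuous (fun z => psi (F z) - psi z *m M).
    move=> z; apply/continuous_dist => e e0.
    have e2 : 0 < e / 2 by rewrite divr_gt0.
    have c1 : {for z, continuous (psi \o F)}.
      by apply: continuous_comp; [exact: F_cont|exact: psi_cont].
    have c2 : {for z, continuous ((fun v => v *m M) \o psi)}.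
      by apply: continuous_comp; [exact: psi_cont|exact: mulmx_continuous].
    apply: filterS2 ((continuous_dist _ z).1 c1 _ e2) ((continuous_dist _ z).1 c2 _ e2).
    move=> w /= h1 h2.
    have -> : psi (F w) - psi w *m M - (psi (F z) - psi z *m M) =
        (psi (F w) - psi (F z)) - (psi w *m M - psi z *m M).
      by rewrite !opprD !opprK addrACA.
    by rewrite (le_trans (ler_normB _ _))// [e]splitr lerD.
  have -> : u = q \o (fun z => psi (F z) - psi z *m M) by [].
  by move=> z; apply: continuous_comp; [exact: cd|exact: lfun_continuous].
have uC z : (q @` [set k | int_vector k]) (u z).
  have : (psi0 @` (f @` W (tproj z))) (psi0 (f (tproj z))).
    by exists (f (tproj z)) => //; exists (tproj z).
  rewrite psi0_f psi0_W => -[_ [w [v [wz vL <-]]]].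
  rewrite toral_map_tproj -F_lift -psi_lift => /esym/tprojP h.
  move: wz; rewrite -psi_lift => /tprojP wz.
  exists (psi (F z) - (w + v) *m M + (w - psi z) *m M).
    by apply: int_vectorD => //; exact: int_vector_mulmx.
  rewrite /u; apply/eqP; rewrite -subr_eq0 -linearB/= -Lc_kernel.
  have -> : psi (F z) - (w + v) *m M + (w - psi z) *m M - (psi (F z) - psi z *m M) =
      - (v *m M).
    rewrite mulmxDl mulmxBl opprD opprB.
    set a := psi (F z); set b := w *m M; set c := v *m M; set d := psi z *m M.
    by clearbody a b c d; apply/rowP => i; rewrite !mxE; ring.
  by rewrite memvN; exact: Lc_inv.
have qC : countable (q @` [set k : E | int_vector k]).
  exact: sub_countable (card_image_le _ _) (countable_int_vector R m).
have uxy : u x = u y := countable_const qC cu uC x y.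
rewrite Lc_kernel -/q.
have -> : psi (F x) - psi (F y) - (psi x - psi y) *m M =
    (psi (F x) - psi x *m M) - (psi (F y) - psi y *m M).
  by rewrite mulmxBl !opprD !opprK addrACA.
by rewrite (linearB q (psi (F x) - _)) subr_eq0; apply/eqP; exact: uxy.
Qed.

(** A leaf on the torus meets the cover in countably many lifted leaves, so a curve in it could a
    priori change from one to another. On a chart ball the label of the lifted leaf is continuous
    with countably many values, hence constant. *)
Lemma leaf_tangent_curve (n : nat) (Ec : T -> {vspace E}) :
  foliation_tangent_to 1 n W Ec -> forall z e, e \in Ec (tproj z) ->
  exists2 c, tangent_curve c z e & \forall t \near 0^'+, leaf psi Lc z (c t).
Proof.
move=> [_ leaves] z e eE; have [S [iota [im _ tg Wz]]] := leaves (tproj z).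
have zS : range iota (tproj z) by rewrite Wz.
have [V [h [phi [v0 [k [chart Vv0 zE kZ iz]]]]]] := chart_at im zS.
rewrite -iz in eE; have [c ce cv] := chart_curve tg k chart Vv0 eE.
rewrite zE in ce; exists (fun t => phi (c t) + k) => //.
have [[oV _] _ _ phiE [C1 _]] := chart.
have [r r0 rV] : exists2 r, 0 < r & forall v : 'rV[R]_1, `|v - v0| <= r -> V v.
  by apply: near_radius; apply: open_nbhs_nbhs.
set q := (\1 - pC)%VF.
pose u v := q (psi (phi v + k) - psi z).
have qC : countable (q @` [set k : E | int_vector k]).
  exact: sub_countable (card_image_le _ _) (countable_int_vector R m).
have u_cont v : `|v - v0| < r -> {for v, continuous u}.
  move=> vr; have [dphi _] := C1 v (rV v (ltW vr)).
  have -> : u = (fun w => q (w - psi z)) \o (psi \o ((fun w => w + k) \o phi)) by [].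
  apply: continuous_comp; last first.
    have -> : (fun w => q (w - psi z)) = q \o (fun w => w - psi z) by [].
    by apply: continuous_comp; [exact: continuous_translate|exact: lfun_continuous].
  apply: continuous_comp; last exact: psi_cont.
  by apply: continuous_comp; [exact: differentiable_continuous|exact: continuous_translate].
have uC v : `|v - v0| < r -> (q @` [set k | int_vector k]) (u v).
  move=> vr; have Vv := rV v (ltW vr).
  have : W (tproj z) (tproj (phi v + k)).
    by rewrite -Wz tprojD// phiE//; exists (h v).
  move=> /W_lattice[l [w [lZ wL E1]]]; exists l => //.
  rewrite /u E1 linearD/=; move: wL; rewrite Lc_kernel => /eqP ->.
  by rewrite addr0.
have near_c : \forall t \near 0^'+, `|c t - v0| < r by exact: cv (near_dist v0 r0).
apply: filterS near_c => t tr; rewrite /leaf/= Lc_kernel -/q.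
have -> : q (psi (phi (c t) + k) - psi z) = u v0.
  exact: (countable_ball_const qC u_cont uC tr).
by rewrite /u zE subrr linear0.
Qed.

End LeafConjugacy.

Lemma ph_splitting (R : realType) (m : nat) (f : torus R m -> torus R m)
    (Es Ec Eu : torus R m -> {vspace 'rV[R]_m}) :
  partially_hyperbolic f Es Ec Eu ->
  [/\ subbundle Es, subbundle Ec, subbundle Eu &
      forall p, (Es p + Ec p + Eu p)%VS = fullv /\ directv (Es p + Ec p + Eu p)].
Proof. by move=> [g [Df [Dg [_ [[sEs _] [sEc _] [sEu _]] _ split_E _]]]]. Qed.

Theorem theorem1p8 (R : realType) (n : nat) (n_ge2 : (2 <= n)%N)
    (f : torus R n.+1 -> torus R n.+1)
    (Es Ec Eu : torus R n.+1 -> {vspace 'rV[R]_n.+1})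
    (f_ph : partially_hyperbolic f Es Ec Eu)
    (dim_Es : forall p, \dim (Es p) = 1%N)
    (dim_Ec : forall p, \dim (Ec p) = 1%N)
    (W : torus R n.+1 -> set (torus R n.+1))
    (W_inv : invariant_foliation f W)
    (W_tangent : foliation_tangent_to 1 n W Ec)
    (f_conj : leaf_conjugate_to_linear_part f W)
    (S : topologicalType) (iota : S -> torus R n.+1)
    (S_submanifold : immersed_submanifold n iota)
    (S_cu : tangent_to n iota (fun p => (Ec p + Eu p)%VS))
    (S_compact : compact [set: S])
    (S_incompressible : incompressible R iota) :
  forall x, range iota x -> ~ (W x `<=` range iota).
Proof.
move=> p _ WpK.
have [sEs sEc sEu E_split] := ph_splitting f_ph.
have [g [F [Fi [Df [Dg [G [lam]]]]]]] := ph_lift f_ph.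
move=> [[FK FiK F_cont Fi_cont] [F_lift Fi_lift] [dF dFi]].
move=> [invS _ _ invU _] [G_metric /andP[lam0 lam1] Es_contr Eu_contr].
have [A [_ [Ls [Lc [Lu [A_ph Ls_dim Lc_dim [psi0 conj]]]]]]] := f_conj.
case: conj => -[psi0' [psi0K psi0'K psi0_cont psi0'_cont]] psi0_W psi0_f.
have [psi [psi' [psiK psi'K psi_cont psi'_cont [psi_lift psi'_lift]]]] :=
  homeo_lift psi0K psi0'K psi0_cont psi0'_cont.
have [N [c1 [c2 [mu [Nb mu01 M_inj [Ls_inv Lc_inv Lu_inv] [Ls_contr Lu_exp]]]]]] :=
  toral_hyperbolic A_ph.
case: Nb => c10 c20 Nb.
have [_ _ _ L_split] := ph_splitting A_ph.
have [L_full L_direct] := L_split (tproj 0).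
have [pS [pC [pU proj]]] := projections_exist L_full L_direct.
have [W_refl W_eq _ _] := W_tangent.1.
have psiZ := lift_lattice psi_cont psi_lift.
have psi'Z := lift_lattice psi'_cont psi'_lift.
have [Mb _ psi_b] := lattice_bounded psi_cont psiZ.
have conj := psi_conjugacy proj Lc_inv W_refl psi0_W psi0_f F_cont psi_cont F_lift psi_lift.
have contr_le (q q' : torus R n.+1) v v' : rnorm G q' v' <= lam * rnorm G q v ->
    rnorm G q' v' <= rnorm G q v.
  by move=> h; rewrite (le_trans h)// ler_piMl ?sqrtr_ge0// ltW.
have [F_diff F_bound] := iterate_bound G_metric dF F_lift invS
  (fun q v vE => contr_le _ _ _ _ (Es_contr q v vE)).
have [Fi_diff Fi_bound] := iterate_bound G_metric dFi Fi_lift invU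
  (fun q v vE => contr_le _ _ _ _ (Eu_contr q v vE)).
have [z zp] := tproj_surj p.
have [pS_mem _ pS_id _ _] := proj.
(* The lifted leaf through [z] projects into [W p], so an inclusion of [W p] in the submanifold
   lifts to the cover. *)
suff main : ~ leaf psi Lc z `<=` submanifold_cover iota.
  apply: main => y yz; apply: WpK; rewrite -zp.
  exact: leaf_sub_W (can_inj psi0K) psi0_W psi_lift _ _ yz.
apply: (@leaf_not_subset R n.+1 (Es \o @tproj R n.+1) (Ec \o @tproj R n.+1)
  (Eu \o @tproj R n.+1) (fun j => iter j F) (fun j => iter j Fi) psi psi' Lc pS pU
  (submanifold_cover iota)).
- exact: F_diff.
- exact: Fi_diff.
- exact: F_bound.
- exact: Fi_bound.
- by move=> x; exact: subbundle_lsc.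
- by move=> x; exact: subbundle_lsc.
- by move=> x; exact: subbundle_lsc.
- by move=> x; exact: dim_Es.
- by move=> x; exact: dim_Ec.
- by move=> x; have [] := E_split (tproj x).
- by move=> x; have [] := E_split (tproj x).
- exact: psiK.
- exact: psi'K.
- exact: psi_cont.
- exact: psi'_cont.
- exact: Lc_dim.
- exact: Lc_proj proj.
- exact: (unstable_separation proj c10 c20 Nb mu01 Ls_inv Lc_inv Lu_inv Lu_exp psi_b conj).
- exact: (stable_separation proj c10 c20 Nb mu01 Ls_inv Lc_inv Lu_inv Ls_contr FiK psi_b conj).
- exact: submanifold_cover_closed S_submanifold S_compact.
- by move=> k e Kk eE; exact: (submanifold_tangent S_submanifold S_cu).
- move=> p0 Kp0; have [E_full E_direct] := E_split (tproj p0).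
  (* The complement of the stable projection fixes [Ec + Eu], the tangent space of the submanifold,
     and kills [Es]: it is the [q] demanded by [submanifold_transverse]. *)
  have [ps [pc [pu [_ _ ids idc idu]]]] := projections_exist E_full E_direct.
  have qid e : e \in (Ec (tproj p0) + Eu (tproj p0))%VS -> (\1 - ps)%VF e = e.
    move=> /memv_addP[a aE [b bE ->]]; have [a0 _ _] := idc _ aE.
    by have [b0 _ _] := idu _ bE; rewrite !lfunE/= !lfunE/= linearD/= a0 b0 addr0 subr0.
  have [rho rho0 H] := submanifold_transverse S_submanifold S_cu S_compact Kp0 qid.
  exists rho => // k k' Kk Kk' kr k'r /ids[kE _ _]; apply: H => //.
  by rewrite !lfunE/= !lfunE/= kE subrr.
- exact: (leaf_tangent_curve proj W_refl psi0_W psi_cont psi_lift W_tangent).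
- exact: psiZ.
- exact: psi'Z.
- by move=> k l Kk lZ; rewrite /submanifold_cover/= tprojD.
- exact: lattice_unif.
- by move=> v; have [v_s _ _] := pS_mem v; have [-> _ _] := pS_id _ v_s.
- exact: (stable_lattice_dense proj c10 Nb mu01 M_inj Ls_inv Lc_inv Lu_inv Ls_contr Ls_dim).
Qed.
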